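(* $\mathsf{ScList}_{\mathbb{N}^{\mathbb{N}}}<_{\mathrm{W}}\widehat{\mathsf{WF}}$.
   Context: A represented space is a set $X$ with a partial surjection $\delta_X:\subseteq\mathbb{N}^{\mathbb{N}}\to X$; $p$ is a name of $x$ if $\delta_X(p)=x$. A problem is a partial multi-valued function $f:\subseteq X\rightrightarrows Y$ between represented spaces. $f\le_{\mathrm{W}} g$ (Weihrauch reducibility) means that there are computable partial maps $\Phi,\Psi:\subseteq\mathbb{N}^{\mathbb{N}}\to\mathbb{N}^{\mathbb{N}}$ such that for every name $p$ of some $x\in\mathrm{dom}(f)$, $\Phi(p)$ is a name of some $y\in\mathrm{dom}(g)$, and for every name $q$ of an element of $g(y)$, $\Psi(p*q)$ is a name of an element of $f(x)$, where $p*q$ is the interleaving of $p$ and $q$. $f<_{\mathrm{W}}g$ means $f\le_{\mathrm{W}}g$ and $g\not\le_{\mathrm{W}}f$. The infinite parallelization of $f$ is $\widehat f((x_i)_{i\in\mathbb{N}})=\{(y_i)_{i\in\mathbb{N}}:(\forall i)\,y_i\in f(x_i)\}$. A tree is a nonempty subset $T$ of $\mathbb{N}^{<\mathbb{N}}$ closed under initial segments; $[T]$ is its set of infinite paths; $T$ is well-founded if $[T]=\emptyset$. $\mathbf{Tr}$ is the space of trees, a tree being represented by its characteristic function (via a fixed computable bijection $\mathbb{N}^{<\mathbb{N}}\cong\mathbb{N}$). $\mathsf{WF}:\mathbf{Tr}\to\{0,1\}$ is given by $\mathsf{WF}(T)=1$ iff $T$ is well-founded. $\mathcal{A}(\mathbb{N}^{\mathbb{N}})$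 is the space of closed subsets of Baire space, a name of $C$ being (the characteristic function of) a tree $T$ with $[T]=C$; this is equivalent to the usual negative representation. $\mathbb{N}$, $2=\{0,1\}$, $\mathbb{N}^{\mathbb{N}}$, products and sequence spaces carry the standard representations. A closed set is perfect if it has no isolated points; the perfect kernel $\mathsf{PK}_{\mathbb{N}^{\mathbb{N}}}(A)$ of a closed set $A$ is the unique perfect $P\subseteq A$ with $A\setminus P$ countable. $\mathsf{ScList}_{\mathbb{N}^{\mathbb{N}}}:\mathcal{A}(\mathbb{N}^{\mathbb{N}})\rightrightarrows\mathbb{N}\times(2\times\mathbb{N}^{\mathbb{N}})^{\mathbb{N}}$ is defined on every closed set $A$; its solutions are all $(n,(b_i,x_i)_{i\in\mathbb{N}})$ such that $A\setminus\mathsf{PK}_{\mathbb{N}^{\mathbb{N}}}(A)=\{x_i:b_i=1\}$, and $n=0$ if $A\setminus\mathsf{PK}_{\mathbb{N}^{\mathbb{N}}}(A)$ is infinite, while $n=|A\setminus\mathsf{PK}_{\mathbb{N}^{\mathbb{N}}}(A)|+1$ if it is finite. *)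

(* Defs.v *)
From HB Require Import structures.
From mathcomp Require Import all_boot.
From mathcomp Require Import mathcomp_extra boolp classical_sets functions.
From mathcomp Require Import cardinality topology.
From Stdlib Require Cantor.

Set Implicit Arguments.
Unset Strict Implicit.
Unset Printing Implicit Defensive.

Local Open Scope classical_set_scope.

(* The product of countably many copies of the discrete space nat. *)
Definition baire : Type := prod_topology (fun _ : nat => nat).
HB.instance Definition _ := Topological.on baire.

Definition pairn (m n : nat) : nat := Cantor.to_nat (m, n).
Definition fstn (n : nat) : nat := (Cantor.of_nat n).1.
Definition sndn (n : nat) : nat := (Cantor.of_nat n).2.

Lemma fstnK m n : fstn (pairn m n) = m.
Proof. by rewrite /fstn /pairn Cantor.cancel_of_to. Qed.

Lemma sndnK m n : sndn (pairn m n) = n.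
Proof. by rewrite /sndn /pairn Cantor.cancel_of_to. Qed.

Lemma pairnK n : pairn (fstn n) (sndn n) = n.
Proof. by rewrite /fstn /sndn /pairn -surjective_pairing Cantor.cancel_to_of. Qed.

(* Kleene's partial recursive functions relative to an oracle, presented as
   unary functions via the Cantor pairing.  The identity is
   [Pair Fst Snd] since the pairing is a bijection. *)
Inductive prog : Type :=
| Zero
| Succ
| Fst
| Snd
| Oracle
| Pair of prog & prog
| Comp of prog & prog
| Rec of prog & prog
| Mu of prog.

(* [eval p c x y]: with oracle [p], the program [c] halts on input [x] with
   output [y].  In the [Rec] case, [r i] is the value at stage [i]; in the
   [Mu] case, the search diverges if it meets an undefined value. *)
Fixpoint eval (p : baire) (c : prog) (x y : nat) {struct c} : Prop :=
  match c with
  | Zero => y = 0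
  | Succ => y = x.+1
  | Fst => y = fstn x
  | Snd => y = sndn x
  | Oracle => y = p x
  | Pair a b => exists u v, [/\ eval p a x u, eval p b x v & y = pairn u v]
  | Comp a b => exists2 u, eval p b x u & eval p a u y
  | Rec a b => exists r : nat -> nat,
      [/\ eval p a (fstn x) (r 0),
          forall i, i < sndn x ->
            eval p b (pairn (fstn x) (pairn i (r i))) (r i.+1)
        & y = r (sndn x)]
  | Mu a => eval p a (pairn x y) 0 /\
      forall i, i < y -> exists k, eval p a (pairn x i) k.+1
  end.

(* A partial map is defined where it does not return [None]; the program
   computing it is unconstrained outside the domain, as usual. *)
Definition computable (F : baire -> option baire) : Prop :=
  exists c : prog, forall p q, F p = Some q -> forall n, eval p c n (q n).

(* [names p x] is the graph of the partial surjection [delta]. *)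
Record repspace := RepSpace {
  carrier :> Type;
  names : baire -> carrier -> Prop;
  names_fun : forall p x y, names p x -> names p y -> x = y;
  names_surj : forall x, exists p, names p x }.

Definition problem (X Y : repspace) : Type := X -> set Y.

Definition dom (X Y : repspace) (f : problem X Y) : set X :=
  [set x | f x !=set0].

Definition interleave (p q : baire) : baire :=
  fun n => if odd n then q n./2 else p n./2.

Definition evens (p : baire) : baire := fun n => p n.*2.
Definition odds (p : baire) : baire := fun n => p n.*2.+1.

Lemma evens_interleave p q : evens (interleave p q) = p.
Proof.
by apply: funext => n; rewrite /evens /interleave odd_double doubleK.
Qed.

Lemma odds_interleave p q : odds (interleave p q) = q.
Proof.
by apply: funext => n; rewrite /odds /interleave /= odd_double /= uphalf_double.
Qed.

Definition weihrauch_le (X Y Z W : repspace)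
    (f : problem X Y) (g : problem Z W) : Prop :=
  exists Phi Psi : baire -> option baire,
  [/\ computable Phi, computable Psi &
    forall (p : baire) (x : X), names p x -> dom f x ->
    exists (p' : baire) (y : Z),
    [/\ Phi p = Some p', names p' y, dom g y &
      forall (q : baire) (z : W), names q z -> g y z ->
      exists (r : baire) (w : Y),
      [/\ Psi (interleave p q) = Some r, names r w & f x w]]].

Definition weihrauch_lt (X Y Z W : repspace)
    (f : problem X Y) (g : problem Z W) : Prop :=
  weihrauch_le f g /\ ~ weihrauch_le g f.

Section StandardSpaces.

Definition nat_names (p : baire) (n : nat) : Prop := p 0 = n.

Lemma nat_names_fun p m n : nat_names p m -> nat_names p n -> m = n.
Proof. by rewrite /nat_names => <- <-. Qed.

Lemma nat_names_surj n : exists p, nat_names p n.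
Proof. by exists (fun=> n). Qed.

Definition natS : repspace := RepSpace nat_names_fun nat_names_surj.

(* [b] is coerced to 0 or 1. *)
Definition bool_names (p : baire) (b : bool) : Prop := p 0 = b.

Lemma bool_names_fun p b c : bool_names p b -> bool_names p c -> b = c.
Proof. by rewrite /bool_names => ->; case: b; case: c. Qed.

Lemma bool_names_surj b : exists p, bool_names p b.
Proof. by exists (fun=> b : nat). Qed.

Definition boolS : repspace := RepSpace bool_names_fun bool_names_surj.

Definition baire_names (p x : baire) : Prop := p = x.

Lemma baire_names_fun p x y : baire_names p x -> baire_names p y -> x = y.
Proof. by move=> <- <-. Qed.

Lemma baire_names_surj x : exists p, baire_names p x.
Proof. by exists x. Qed.

Definition baireS : repspace := RepSpace baire_names_fun baire_names_surj.

Variables X Y : repspace.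

Definition prod_names (p : baire) (z : X * Y) : Prop :=
  names (evens p) z.1 /\ names (odds p) z.2.

Lemma prod_names_fun p z w : prod_names p z -> prod_names p w -> z = w.
Proof.
case: z w => [x y] [x' y'] [/= px py] [/= px' py'].
by rewrite (names_fun px px') (names_fun py py').
Qed.

Lemma prod_names_surj z : exists p, prod_names p z.
Proof.
case: z => x y; have [p px] := names_surj x; have [q qy] := names_surj y.
exists (interleave p q); split => /=.
  by rewrite evens_interleave.
by rewrite odds_interleave.
Qed.

Definition prodS : repspace := RepSpace prod_names_fun prod_names_surj.

Definition seq_names (p : baire) (x : nat -> X) : Prop :=
  forall i, names (fun j => p (pairn i j)) (x i).

Lemma seq_names_fun p x y : seq_names p x -> seq_names p y -> x = y.
Proof. by move=> px py; apply: funext => i; apply: names_fun (px i) (py i). Qed.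

Lemma seq_names_surj x : exists p, seq_names p x.
Proof.
have [q qx] := choice (fun i => names_surj (x i)).
exists (fun n => q (fstn n) (sndn n)) => i.
suff -> : (fun j => q (fstn (pairn i j)) (sndn (pairn i j))) = q i by [].
by apply: funext => j; rewrite fstnK sndnK.
Qed.

Definition seqS : repspace := RepSpace seq_names_fun seq_names_surj.

End StandardSpaces.

Definition parallelization (X Y : repspace) (f : problem X Y) :
    problem (seqS X) (seqS Y) :=
  fun x => [set y | forall i, f (x i) (y i)].

Record tree := Tree {
  nodes :> set (seq nat);
  tree_nonempty : nodes !=set0;
  tree_prefix : forall s t, prefix s t -> nodes t -> nodes s }.

Lemma tree_ext (S T : tree) : nodes S = nodes T -> S = T.
Proof.
case: S T => [S S0 Sp] [T T0 Tp] /= ST; case: T / ST T0 Tp => T0 Tp.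
by congr Tree; apply: Prop_irrelevance.
Qed.

Definition paths (T : tree) : set baire :=
  [set x | forall n, nodes T (mkseq x n)].

Definition well_founded_tree (T : tree) : Prop := paths T = set0.

(* Nodes are numbered by the bijection [CodeSeq.code]. *)
Definition tree_names (p : baire) (T : tree) : Prop :=
  forall s : seq nat, p (CodeSeq.code s) = `[< nodes T s >].

Lemma tree_names_fun p S T : tree_names p S -> tree_names p T -> S = T.
Proof.
move=> pS pT; apply: tree_ext; apply: funext => s; apply/propext.
have := pS s; rewrite pT.
by case: asboolP; case: asboolP.
Qed.

Lemma tree_names_surj T : exists p, tree_names p T.
Proof.
by exists (fun n => `[< nodes T (CodeSeq.decode n) >] : nat) => s;
  rewrite CodeSeq.codeK.
Qed.

Definition treeS : repspace := RepSpace tree_names_fun tree_names_surj.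

Definition WF : problem treeS boolS :=
  fun T => [set b : bool | b = `[< well_founded_tree T >]].

Record closed_baire := ClosedBaire {
  closed_set :> set baire;
  closed_setP : closed closed_set }.

Lemma closed_baire_ext (A B : closed_baire) :
  closed_set A = closed_set B -> A = B.
Proof.
case: A B => [A cA] [B cB] /= AB; case: B / AB cB => cB.
by congr ClosedBaire; apply: Prop_irrelevance.
Qed.

Definition closed_names (p : baire) (A : closed_baire) : Prop :=
  exists2 T : tree, tree_names p T & paths T = closed_set A.

Lemma closed_names_fun p A B : closed_names p A -> closed_names p B -> A = B.
Proof.
move=> [S pS SA] [T pT TB]; apply: closed_baire_ext.
by rewrite -SA -TB (tree_names_fun pS pT).
Qed.

Lemma mkseq_eqP (x y : baire) n :
  mkseq y n = mkseq x n <-> forall i, i < n -> y i = x i.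
Proof.
split=> [E i ltin|E]; first by rewrite -(nth_mkseq 0 y ltin) E nth_mkseq.
by apply/eq_in_map => i; rewrite mem_iota => /andP[_]; exact: E.
Qed.

Lemma nbhs_cylinder (x : baire) n :
  nbhs x [set y : baire | mkseq y n = mkseq x n].
Proof.
elim: n => [|n IH]; first exact: filterS filterT.
have H : nbhs x (proj n @^-1` [set x n] : set baire).
  apply: (@proj_continuous nat (fun=> nat) n x [set x n]).
  exact: (discrete_set1 (x n : nat)).
by apply: filterS (filterI IH H) => y [/= E1];
  rewrite !mkseqS E1 /proj /= => ->.
Qed.

Lemma cylinder_basis (x : baire) (U : set baire) :
  nbhs x U -> exists n, [set y : baire | mkseq y n = mkseq x n] `<=` U.
Proof.
pose F : set_system baire :=
  [set V | exists n, [set y : baire | mkseq y n = mkseq x n] `<=` V].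
have FF : Filter F.
  split; first by exists 0.
  - move=> P Q [m Pm] [n Qn]; exists (maxn m n) => y /= /mkseq_eqP E; split.
      by apply/Pm/mkseq_eqP => i im; apply: E; rewrite leq_max im.
    by apply/Qn/mkseq_eqP => i im; apply: E; rewrite leq_max im orbT.
  - by move=> P Q PQ [n Pn]; exists n => y /Pn /PQ.
suff : F --> x by exact.
apply/cvg_sup => i.
rewrite cvg_image; last first.
  by apply/seteqP; split=> v // _; exists (fun=> v : nat).
move=> V /= /(@nbhs_singleton nat) Vx.
exists [set y : baire | V (y i)].
  exists i.+1 => y /= /mkseq_eqP /(_ i (ltnSn i)) ->; exact: Vx.
apply/seteqP; split=> v /=; first by move=> [y Vy <-].
by move=> Vv; exists (fun=> v : nat).
Qed.

Lemma closed_cylinderP (A : set baire) (x : baire) : closed A ->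
  (forall n, exists2 y, A y & mkseq y n = mkseq x n) -> A x.
Proof.
move=> cA H; apply: cA => U /cylinder_basis [n nU].
by have [y Ay yx] := H n; exists y; split=> //; apply: nU.
Qed.

Lemma paths_closed (T : tree) : closed (paths T).
Proof.
move=> x clx n; have [y [Ty /= <-]] := clx _ (nbhs_cylinder x n).
exact: Ty.
Qed.

Lemma closed_names_surj A : exists p, closed_names p A.
Proof.
pose N := [set s : seq nat |
  s = [::] \/ exists2 y : baire, closed_set A y & s = mkseq y (size s)].
have N0 : N !=set0 by exists [::]; left.
have Np s t : prefix s t -> N t -> N s.
  move=> /prefixP [u ->] [/eqP|[y Ay E]].
    by rewrite -size_eq0 size_cat addn_eq0 => /andP[/nilP -> _]; left.
  right; exists y => //.
  have := congr1 (take (size s)) E.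
  rewrite take_size_cat // => ->; rewrite size_takel ?size_mkseq ?size_cat ?leq_addr //.
  by rewrite /mkseq -map_take take_iota (minn_idPl _) // leq_addr.
have [p pT] := tree_names_surj (Tree N0 Np).
exists p; exists (Tree N0 Np) => //.
apply/seteqP; split=> x /=; last first.
  by move=> Ax n; right; exists x; rewrite ?size_mkseq.
move=> Tx.
have Tx' n : exists2 y, closed_set A y & mkseq y n = mkseq x n.
  have [//|[y Ay E]] := Tx n.+1.
  exists y => //; apply/mkseq_eqP => i lt_in.
  by move: E; rewrite size_mkseq => /esym/mkseq_eqP; apply; apply: ltnW.
exact: (closed_cylinderP (@closed_setP A) Tx').
Qed.

Definition closedS : repspace := RepSpace closed_names_fun closed_names_surj.

(* [perfect_set] is closed without isolated points, see [perfectP]. *)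
Definition is_perfect_kernel (A P : set baire) : Prop :=
  [/\ perfect_set P, P `<=` A & countable (A `\` P)].

(* For each closed [A], the set [P] below exists and is unique by the
   Cantor-Bendixson theorem, so the domain is the whole space. *)
Definition ScList :
    problem closedS (prodS natS (seqS (prodS boolS baireS))) :=
  fun A => [set y : nat * (nat -> bool * baire) |
    exists2 P : set baire, is_perfect_kernel A P &
      let S := closed_set A `\` P in
      [/\ S = [set x | exists i, y.2 i = (true, x)],
          infinite_set S -> y.1 = 0
        & forall k, (S #= `I_k)%card -> y.1 = k.+1]].

(* Main.v *)
(* Both halves rest on the complexity of the scattered part S of A = [T].

   A level is a finite list of nodes of T, refined by any list of nodes that
   contains two incompatible extensions of each of its members.  A node t is
   scattered if no infinite refinement starts at [:: t]; then S is the set of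
   paths through scattered nodes.  Ranks are compared by simulations, so no
   ordinals are needed.  A scattered node t has at most one path x in T all of
   whose nodes have the rank of t: otherwise t could be refined without loss of
   rank.  Each element of S arises in this way.  The rank of the tree of nodes
   above a scattered t without path is below omega times the rank of t, so "t is
   not scattered, or no path passes through t" is again a simulation.  Hence the
   elements and the number of elements of S are determined by countably many
   Sigma-1-1 questions on T, each of them the ill-foundedness of a computable
   tree, and a search through the answers finds a solution.

   Conversely, suppose that WF^ reduces to ScList.  Any list of members of S
   extends to a solution, so T_i is well-founded iff no finite part of a solution
   forces the output 0.  As a node avoids S in a Sigma-1-1 way, this expresses
   well-foundedness of T_i by a Sigma-1-1 formula, up to the cardinality n that
   comes with the solution.  Membership of s in the tree of a Sigma-1-1 formula
   only uses the oracle below the length of s, so a course-of-values recursion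
   yields a sequence of trees T_n that are ill-founded iff the formula with
   cardinality n says that they are well-founded. *)

From mathcomp Require Import all_boot.
From mathcomp Require Import mathcomp_extra boolp classical_sets functions.
From mathcomp Require Import cardinality topology.
From mathcomp Require Import zify.
Require Import Defs.

Set Implicit Arguments.
Unset Strict Implicit.
Unset Printing Implicit Defensive.

Local Open Scope classical_set_scope.

Notation code := CodeSeq.code.
Notation decode := CodeSeq.decode.

(** * Primitive recursive functionals *)

Fixpoint prec (a : nat) (b : nat -> nat -> nat) (n : nat) : nat :=
  if n is m.+1 then b m (prec a b m) else a.

(** A predicate on functionals rather than a syntax, so that closure is proved directly for terms
    [fun p n => ...]; [PR_prog] extracts programs. All members are total. *)
Inductive PR : (baire -> nat -> nat) -> Prop :=
| PR_zero : PR (fun _ _ => 0)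
| PR_succ : PR (fun _ n => n.+1)
| PR_fst : PR (fun _ n => fstn n)
| PR_snd : PR (fun _ n => sndn n)
| PR_oracle : PR (fun p n => p n)
| PR_pair F G : PR F -> PR G -> PR (fun p n => pairn (F p n) (G p n))
| PR_comp F G : PR F -> PR G -> PR (fun p n => F p (G p n))
| PR_prec F G : PR F -> PR G ->
    PR (fun p n => prec (F p (fstn n))
      (fun i r => G p (pairn (fstn n) (pairn i r))) (sndn n)).

Lemma PR_eq F G : (forall p n, F p n = G p n) -> PR F -> PR G.
Proof. by move=> FG; have -> : F = G by apply/funext => p; apply/funext. Qed.

Lemma eq_prec a a' b b' n : a = a' -> (forall i r, i < n -> b i r = b' i r) ->
  prec a b n = prec a' b' n.
Proof.
move=> -> bb'; elim: n bb' => //= n IH bb'.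
by rewrite bb' // IH // => i r ltin; apply: bb'; apply: ltnW.
Qed.

Lemma PR_prog F : PR F -> exists c, forall p n, eval p c n (F p n).
Proof.
elim=> [|||||A B _ [a aP] _ [b bP]|A B _ [a aP] _ [b bP]|A B _ [a aP] _ [b bP]].
- by exists Zero.
- by exists Succ.
- by exists Fst.
- by exists Snd.
- by exists Oracle.
- by exists (Pair a b) => p n /=; exists (A p n), (B p n).
- by exists (Comp a b) => p n /=; exists (B p n).
- exists (Rec a b) => p n /=.
  exists (prec (A p (fstn n)) (fun i r => B p (pairn (fstn n) (pairn i r)))).
  by split=> //= i _; apply: bP.
Qed.

Lemma PR_id : PR (fun _ n => n).
Proof. by apply: PR_eq (PR_pair PR_fst PR_snd) => p n; rewrite pairnK. Qed.

Lemma PR_const k : PR (fun _ _ => k).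
Proof. by elim: k => [|k IH]; [exact: PR_zero|exact: PR_comp PR_succ IH]. Qed.

Lemma PR_app1 F t : PR F -> PR t -> PR (fun p n => F p (t p n)).
Proof. exact: PR_comp. Qed.

Lemma PR_app2 (F : baire -> nat -> nat -> nat) t u :
  PR (fun p n => F p (fstn n) (sndn n)) -> PR t -> PR u ->
  PR (fun p n => F p (t p n) (u p n)).
Proof.
move=> FP tP uP; apply: PR_eq (PR_comp FP (PR_pair tP uP)) => p n.
by rewrite fstnK sndnK.
Qed.

Lemma PR_rec (a : baire -> nat -> nat) b k :
  PR a -> PR (fun p n => b p (fstn n) (fstn (sndn n)) (sndn (sndn n))) -> PR k ->
  PR (fun p n => prec (a p n) (b p n) (k p n)).
Proof.
move=> aP bP kP.
apply: PR_eq (PR_comp (PR_prec aP bP) (PR_pair PR_id kP)) => p n.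
by rewrite fstnK sndnK; apply: eq_prec => // i r _; rewrite !(fstnK, sndnK).
Qed.

Lemma PR_S t : PR t -> PR (fun p n => (t p n).+1).
Proof. exact: PR_comp PR_succ. Qed.
Lemma PR_fstn t : PR t -> PR (fun p n => fstn (t p n)).
Proof. exact: PR_comp PR_fst. Qed.
Lemma PR_sndn t : PR t -> PR (fun p n => sndn (t p n)).
Proof. exact: PR_comp PR_snd. Qed.

(** Oracles computed from [p] uniformly in a number parameter. *)
Definition PB (G : baire -> nat -> baire) : Prop :=
  PR (fun p n => G p (fstn n) (sndn n)).

Lemma PR_orc G t : PB G -> PR t -> PR (fun p n => G p n (t p n)).
Proof.
move=> GP tP; apply: PR_eq (PR_comp GP (PR_pair PR_id tP)) => p n.
by rewrite fstnK sndnK.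
Qed.

Lemma PB_id : PB (fun p _ => p).
Proof. exact: PR_comp PR_oracle PR_snd. Qed.

(** As the substituted oracle depends on the input, the induction keeps the input as a parameter
    beside the running argument. *)
Lemma PR_subst F G t : PR F -> PB G -> PR t -> PR (fun p n => F (G p n) (t p n)).
Proof.
move=> FP GP tP.
suff H : PR (fun p n => F (G p (fstn n)) (sndn n)).
  apply: PR_eq (PR_comp H (PR_pair PR_id tP)) => p n; by rewrite fstnK sndnK.
elim: FP => {tP t F} [|||||A B _ IA _ IB|A B _ IA _ IB|A B _ IA _ IB].
- exact: PR_zero.
- exact: PR_S PR_snd.
- exact: PR_fstn PR_snd.
- exact: PR_sndn PR_snd.
- exact: GP.
- exact: PR_pair.
- apply: PR_eq (PR_comp IA (PR_pair PR_fst IB)) => p n; by rewrite fstnK sndnK.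
- apply: (@PR_rec (fun p n => A (G p (fstn n)) (fstn (sndn n)))
    (fun p n i r => B (G p (fstn n)) (pairn (fstn (sndn n)) (pairn i r)))).
  + apply: PR_eq (PR_comp IA (PR_pair PR_fst (PR_fstn PR_snd))) => p n.
    by rewrite fstnK sndnK.
  + apply: PR_eq (PR_comp IB (PR_pair (PR_fstn PR_fst)
      (PR_pair (PR_fstn (PR_sndn PR_fst)) PR_snd))) => p n.
    by rewrite fstnK sndnK pairnK.
  + exact: PR_sndn PR_snd.
Qed.

Lemma PB_subst G t : PB G -> PR t -> PB (fun p n => G p (t p n)).
Proof.
move=> GP tP.
apply: PR_eq (PR_comp GP (PR_pair (PR_comp tP PR_fst) PR_snd)) => p n.
by rewrite fstnK sndnK.
Qed.

(** * Arithmetic and bounded search *)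

Lemma PR_prec_eq (h : baire -> nat -> nat) a b k :
  PR a -> PR (fun p n => b p (fstn n) (fstn (sndn n)) (sndn (sndn n))) -> PR k ->
  (forall p n, h p n = prec (a p n) (b p n) (k p n)) -> PR h.
Proof. by move=> aP bP kP H; apply: PR_eq (PR_rec aP bP kP) => p n. Qed.

Lemma PR_add t u : PR t -> PR u -> PR (fun p n => t p n + u p n).
Proof.
move=> tP uP; apply: (PR_prec_eq (b := fun _ _ _ r => r.+1) tP _ uP).
  exact: PR_S (PR_sndn PR_snd).
by move=> p n; elim: (u p n) => [|k /= <-]; rewrite (addn0, addnS).
Qed.

Lemma PR_pred t : PR t -> PR (fun p n => (t p n).-1).
Proof.
move=> tP; apply: (PR_prec_eq (b := fun _ _ i _ => i) PR_zero _ tP).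
  exact: PR_fstn PR_snd.
by move=> p n; case: (t p n).
Qed.

Lemma PR_sub t u : PR t -> PR u -> PR (fun p n => t p n - u p n).
Proof.
move=> tP uP; apply: (PR_prec_eq (b := fun _ _ _ r => r.-1) tP _ uP).
  exact: PR_pred (PR_sndn PR_snd).
by move=> p n; elim: (u p n) => [|k /= <-]; rewrite (subn0, subnS).
Qed.

Lemma PR_mul t u : PR t -> PR u -> PR (fun p n => t p n * u p n).
Proof.
move=> tP uP.
apply: (PR_prec_eq (b := fun p n _ r => r + t p n) PR_zero _ uP).
  exact: PR_add (PR_sndn PR_snd) (PR_comp tP PR_fst).
by move=> p n; elim: (u p n) => [|k /= <-]; rewrite (muln0, mulnSr).
Qed.

Lemma PR_double t : PR t -> PR (fun p n => (t p n).*2).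
Proof. by move=> tP; apply: PR_eq (PR_add tP tP) => p n; rewrite addnn. Qed.

Lemma PR_if (b : baire -> nat -> bool) t u : PR (fun p n => b p n : nat) ->
  PR t -> PR u -> PR (fun p n => if b p n then t p n else u p n).
Proof.
move=> bP tP uP; apply: (PR_prec_eq (b := fun p n _ _ => t p n) uP _ bP).
  exact: PR_comp tP PR_fst.
by move=> p n; case: (b p n).
Qed.

Lemma PR_eq0 t : PR t -> PR (fun p n => (t p n == 0) : nat).
Proof.
move=> tP; apply: (PR_prec_eq (b := fun _ _ _ _ => 0) (PR_const 1) _ tP).
  exact: PR_zero.
by move=> p n; case: (t p n).
Qed.

Lemma PR_negb (b : baire -> nat -> bool) : PR (fun p n => b p n : nat) ->
  PR (fun p n => ~~ b p n : nat).
Proof.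
by move=> bP; apply: PR_eq (PR_if bP PR_zero (PR_const 1)) => p n; case: (b p n).
Qed.

Lemma PR_andb (b c : baire -> nat -> bool) : PR (fun p n => b p n : nat) ->
  PR (fun p n => c p n : nat) -> PR (fun p n => b p n && c p n : nat).
Proof.
by move=> bP cP; apply: PR_eq (PR_mul bP cP) => p n; case: (b p n); case: (c p n).
Qed.

Lemma PR_orb (b c : baire -> nat -> bool) : PR (fun p n => b p n : nat) ->
  PR (fun p n => c p n : nat) -> PR (fun p n => b p n || c p n : nat).
Proof.
by move=> bP cP; apply: PR_eq (PR_if bP (PR_const 1) cP) => p n; case: (b p n).
Qed.

Lemma PR_leq t u : PR t -> PR u -> PR (fun p n => (t p n <= u p n) : nat).
Proof. by move=> tP uP; exact: PR_eq0 (PR_sub tP uP). Qed.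

Lemma PR_eqn t u : PR t -> PR u -> PR (fun p n => (t p n == u p n) : nat).
Proof.
move=> tP uP; apply: PR_eq (PR_andb (PR_leq tP uP) (PR_leq uP tP)) => p n.
by rewrite eqn_leq.
Qed.

Lemma PR_odd t : PR t -> PR (fun p n => odd (t p n) : nat).
Proof.
move=> tP; apply: (PR_prec_eq (b := fun _ _ _ r => 1 - r) PR_zero _ tP).
  exact: PR_sub (PR_const 1) (PR_sndn PR_snd).
by move=> p n; elim: (t p n) => //= k <-; case: (odd k).
Qed.

Lemma PR_half t : PR t -> PR (fun p n => (t p n)./2).
Proof.
move=> tP; apply: (PR_prec_eq (b := fun _ _ i r => r + odd i) PR_zero _ tP).
  exact: PR_add (PR_sndn PR_snd) (PR_odd (PR_fstn PR_snd)).
by move=> p n; elim: (t p n) => //= k <-; lia.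
Qed.

Lemma PR_min t u : PR t -> PR u -> PR (fun p n => minn (t p n) (u p n)).
Proof.
move=> tP uP; apply: PR_eq (PR_sub tP (PR_sub tP uP)) => p n; lia.
Qed.

Lemma PR_exp2 t : PR t -> PR (fun p n => 2 ^ t p n).
Proof.
move=> tP; apply: (PR_prec_eq (b := fun _ _ _ r => r.*2) (PR_const 1) _ tP).
  exact: PR_double (PR_sndn PR_snd).
by move=> p n; elim: (t p n) => //= k <-; rewrite expnS mul2n.
Qed.

Lemma PR_all (b : baire -> nat -> nat -> bool) k :
  PR (fun p n => b p (fstn n) (sndn n) : nat) -> PR k ->
  PR (fun p n => all (b p n) (iota 0 (k p n)) : nat).
Proof.
move=> bP kP.
apply: (PR_prec_eq (b := fun p n i r => b p n i * r) (PR_const 1) _ kP).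
  apply: PR_mul (PR_sndn PR_snd).
  exact: (PR_app2 (F := fun p n i => b p n i) bP PR_fst (PR_fstn PR_snd)).
move=> p n; elim: (k p n) => // i IH.
by rewrite -addn1 iotaD all_cat /= add0n andbT addn1 /= -IH; case: (b p n i); case: (all _ _).
Qed.

Lemma PR_has (b : baire -> nat -> nat -> bool) k :
  PR (fun p n => b p (fstn n) (sndn n) : nat) -> PR k ->
  PR (fun p n => has (b p n) (iota 0 (k p n)) : nat).
Proof.
move=> bP kP.
apply: PR_eq (PR_negb (PR_all (b := fun p n i => ~~ b p n i) (PR_negb bP) kP)) => p n.
by rewrite -has_predC; congr (nat_of_bool _); apply: eq_has => i /=; rewrite negbK.
Qed.

(** Bounded minimization by iteration: the candidate [r] moves up until it satisfies [b]. The value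
    is the bound if nothing below it satisfies [b]. *)
Definition bmu (b : nat -> bool) : nat -> nat :=
  prec 0 (fun _ r => if b r then r else r.+1).

Lemma bmuE (b : nat -> bool) k a : b a -> (forall i, i < a -> ~~ b i) -> a <= k -> bmu b k = a.
Proof.
move=> ba bmin; suff -> : bmu b k = minn a k by move/minn_idPl.
rewrite /bmu; elim: k => [|k /= ->]; first by rewrite minn0.
have [lek|ltk] := leqP a k; first by rewrite ba; lia.
by rewrite (negbTE (bmin _ _)) //; lia.
Qed.

Lemma bmu_none (b : nat -> bool) k : (forall i, i < k -> ~~ b i) -> bmu b k = k.
Proof.
rewrite /bmu; elim: k => //= k IH bn; rewrite IH => [|i ik]; last exact/bn/ltnW.
by rewrite (negbTE (bn _ _)).
Qed.

Lemma PR_bmu (b : baire -> nat -> nat -> bool) k :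
  PR (fun p n => b p (fstn n) (sndn n) : nat) -> PR k ->
  PR (fun p n => bmu (b p n) (k p n)).
Proof.
move=> bP kP.
apply: (PR_rec (b := fun p n _ r => if b p n r then r else r.+1) PR_zero _ kP).
apply: PR_if; [|exact: PR_sndn PR_snd|exact: PR_S (PR_sndn PR_snd)].
exact: (PR_app2 (F := fun p n i => b p n i) bP PR_fst (PR_sndn PR_snd)).
Qed.

(** * Coding of finite lists *)

Definition codecons (v m : nat) := 2 ^ v * m.*2.+1.

Lemma codeconsE v m : codecons v m = code (v :: decode m).
Proof. by rewrite /codecons /= CodeSeq.decodeK. Qed.

Lemma codecons_inj v m v' m' : codecons v m = codecons v' m' -> v = v' /\ m = m'.
Proof.
rewrite !codeconsE => /(can_inj CodeSeq.codeK) [-> E]; split=> //.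
exact: (can_inj CodeSeq.decodeK).
Qed.

Lemma codecons_gt v m : (v < codecons v m) /\ (m < codecons v m).
Proof.
split; first by rewrite /codecons -[v.+1]muln1 leq_mul // ltn_expl.
by rewrite /codecons -[m.+1]mul1n leq_mul ?expn_gt0 // ltnS -addnn leq_addr.
Qed.

Lemma PR_codecons t u : PR t -> PR u -> PR (fun p n => codecons (t p n) (u p n)).
Proof. by move=> tP uP; exact: PR_mul (PR_exp2 tP) (PR_S (PR_double uP)). Qed.

(** Both components are below the code by [codecons_gt], so bounded search finds them. At the code 0
    of the empty list both searches return 0. *)
Definition chead (c : nat) := bmu (fun v => has (fun m => codecons v m == c) (iota 0 c)) c.
Definition ctail (c : nat) := bmu (fun m => codecons (chead c) m == c) c.

Lemma chead_code s : chead (code s) = head 0 s.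
Proof.
case: s => [|v s] //; have E : code (v :: s) = codecons v (code s) by [].
rewrite /chead E; have [lv ls] := codecons_gt v (code s).
apply: bmuE => [|i iv|]; last exact: ltnW.
  by apply/hasP; exists (code s); rewrite ?mem_iota.
by apply/hasPn => m _; apply/eqP => /codecons_inj [Ei _]; rewrite Ei ltnn in iv.
Qed.

Lemma ctail_code s : ctail (code s) = code (behead s).
Proof.
rewrite /ctail chead_code; case: s => [|v s]; first by rewrite bmu_none.
have E : code (v :: s) = codecons v (code s) by [].
rewrite E /=; have [lv ls] := codecons_gt v (code s).
apply: bmuE => [|i iv|]; [exact: eqxx| |exact: ltnW].
by apply/eqP => /codecons_inj [_ Ei]; rewrite Ei ltnn in iv.
Qed.

Lemma PR_chead t : PR t -> PR (fun p n => chead (t p n)).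
Proof.
move=> tP.
apply: (PR_bmu (b := fun p n v => has (fun m => codecons v m == t p n)
  (iota 0 (t p n)))) => //.
apply: (PR_has (b := fun p n m => codecons (sndn n) m == t p (fstn n)));
  last exact: PR_comp tP PR_fst.
apply: PR_eqn; last exact: PR_comp tP (PR_fstn PR_fst).
exact: PR_codecons (PR_sndn PR_fst) PR_snd.
Qed.

Lemma PR_ctail t : PR t -> PR (fun p n => ctail (t p n)).
Proof.
move=> tP.
apply: (PR_bmu (b := fun p n m => codecons (chead (t p n)) m == t p n)) => //.
apply: PR_eqn; last exact: PR_comp tP PR_fst.
exact: PR_codecons (PR_chead (PR_comp tP PR_fst)) PR_snd.
Qed.

Lemma iter_ctail i c : prec c (fun _ r => ctail r) i = code (drop i (decode c)).
Proof.
elim: i => [|i /= ->]; first by rewrite drop0 CodeSeq.decodeK.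
by rewrite ctail_code -drop1 drop_drop.
Qed.

Lemma PR_drop t u : PR t -> PR u ->
  PR (fun p n => code (drop (u p n) (decode (t p n)))).
Proof.
move=> tP uP; apply: (PR_prec_eq (b := fun _ _ _ r => ctail r) tP _ uP).
  exact: PR_ctail (PR_sndn PR_snd).
by move=> p n; rewrite iter_ctail.
Qed.

Lemma PR_nth t u : PR t -> PR u ->
  PR (fun p n => nth 0 (decode (t p n)) (u p n)).
Proof.
move=> tP uP; apply: PR_eq (PR_chead (PR_drop tP uP)) => p n.
by rewrite chead_code -nth0 nth_drop addn0.
Qed.

Lemma size_leq_code s : size s <= code s.
Proof.
elim: s => //= v s IH; apply: leq_trans (codecons_gt v (code s)).2; exact: IH.
Qed.

Lemma PR_size t : PR t -> PR (fun p n => size (decode (t p n))).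
Proof.
move=> tP.
apply: PR_eq (PR_bmu (b := fun p n i => code (drop i (decode (t p n))) == 0) _ tP).
  move=> p n; have sz := size_leq_code (decode (t p n)).
  rewrite CodeSeq.decodeK in sz; apply: bmuE => // [|i lti].
    by rewrite drop_size.
  by rewrite -[0]/(code [::]) (can_eq CodeSeq.codeK) -size_eq0 size_drop subn_eq0 -ltnNge.
exact: PR_eq0 (PR_drop (PR_comp tP PR_fst) PR_snd).
Qed.

Lemma PR_mkseq (X : baire -> nat -> nat -> nat) k :
  PR (fun p n => X p (fstn n) (sndn n)) -> PR k ->
  PR (fun p n => code (mkseq (X p n) (k p n))).
Proof.
move=> XP kP.
(* The list is built from its end, so stage [i] prepends the entry with index [k p n - i.+1]. *)
apply: (PR_prec_eq (b := fun p n i r => codecons (X p n (k p n - i.+1)) r)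
  PR_zero _ kP).
  apply: PR_codecons; last exact: PR_sndn PR_snd.
  apply: (PR_app2 (F := fun p n i => X p n i)) => //; first exact: PR_fst.
  exact: PR_sub (PR_comp kP PR_fst) (PR_S (PR_fstn PR_snd)).
move=> p n; set K := k p n; have {2}-> : K = K - K + K by rewrite subnn.
suff H j : j <= K -> prec 0 (fun i r => codecons (X p n (K - i.+1)) r) j =
    code (map (X p n) (iota (K - j) j)).
  by rewrite subnn H // subnn.
elim: j => // j IH jK; rewrite /= IH; last exact: ltnW.
by rewrite codeconsE CodeSeq.codeK; congr (code (_ :: map _ (iota _ _))); lia.
Qed.

Lemma take_mkseq (s : seq nat) k : take k s = mkseq (nth 0 s) (minn k (size s)).
Proof.
apply: (@eq_from_nth _ 0) => [|i].
  by rewrite size_mkseq size_take_min.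
by rewrite size_take_min => ik; rewrite nth_mkseq // nth_take //; lia.
Qed.

Lemma PR_take t u : PR t -> PR u ->
  PR (fun p n => code (take (u p n) (decode (t p n)))).
Proof.
move=> tP uP; apply: PR_eq (PR_mkseq (X := fun p n i => nth 0 (decode (t p n)) i)
  _ (PR_min uP (PR_size tP))) => [p n|]; first by rewrite take_mkseq.
exact: PR_nth (PR_comp tP PR_fst) PR_snd.
Qed.

Lemma PR_prefix t u : PR t -> PR u ->
  PR (fun p n => prefix (decode (t p n)) (decode (u p n)) : nat).
Proof.
move=> tP uP; apply: PR_eq (PR_eqn (PR_take uP (PR_size tP)) tP) => p n.
by rewrite -{2}[t p n]CodeSeq.decodeK (can_eq CodeSeq.codeK) prefixE.
Qed.

Lemma PB_evens G : PB G -> PB (fun p n => evens (G p n)).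
Proof. by move=> GP; exact: (PR_orc (PB_subst GP PR_fst) (PR_double PR_snd)). Qed.

Lemma PB_odds G : PB G -> PB (fun p n => odds (G p n)).
Proof.
by move=> GP; exact: (PR_orc (PB_subst GP PR_fst) (PR_S (PR_double PR_snd))).
Qed.

Lemma PB_interleave G H : PB G -> PB H -> PB (fun p n => interleave (G p n) (H p n)).
Proof.
move=> GP HP; apply: PR_if; first exact: PR_odd PR_snd.
  exact: (PR_orc (PB_subst HP PR_fst) (PR_half PR_snd)).
exact: (PR_orc (PB_subst GP PR_fst) (PR_half PR_snd)).
Qed.

Ltac pr1 := lazymatch goal with
  | |- PB (fun p n => evens (@?G p n)) => apply (@PB_evens G)
  | |- PB (fun p n => odds (@?G p n)) => apply (@PB_odds G)
  | |- PB (fun p n => interleave (@?G p n) (@?H p n)) => apply (@PB_interleave G H)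
  | |- PB (fun p n => p) => exact: PB_id
  | |- PR (fun p n => n) => exact: PR_id
  | |- PR (fun p n => p (@?t p n)) => apply (@PR_app1 _ t PR_oracle)
  | |- PR (fun p n => evens (@?G p n) (@?t p n)) =>
      apply (@PR_orc (fun p n => evens (G p n)) t)
  | |- PR (fun p n => odds (@?G p n) (@?t p n)) =>
      apply (@PR_orc (fun p n => odds (G p n)) t)
  | |- PR (fun p n => interleave (@?G p n) (@?H p n) (@?t p n)) =>
      apply (@PR_orc (fun p n => interleave (G p n) (H p n)) t)
  | |- PR (fun p n => S (@?t p n)) => apply (@PR_S t)
  | |- PR (fun p n => predn (@?t p n)) => apply (@PR_pred t)
  | |- PR (fun p n => fstn (@?t p n)) => apply (@PR_fstn t)
  | |- PR (fun p n => sndn (@?t p n)) => apply (@PR_sndn t)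
  | |- PR (fun p n => pairn (@?t p n) (@?u p n)) => apply (@PR_pair t u)
  | |- PR (fun p n => addn (@?t p n) (@?u p n)) => apply (@PR_add t u)
  | |- PR (fun p n => subn (@?t p n) (@?u p n)) => apply (@PR_sub t u)
  | |- PR (fun p n => muln (@?t p n) (@?u p n)) => apply (@PR_mul t u)
  | |- PR (fun p n => double (@?t p n)) => apply (@PR_double t)
  | |- PR (fun p n => half (@?t p n)) => apply (@PR_half t)
  | |- PR (fun p n => minn (@?t p n) (@?u p n)) => apply (@PR_min t u)
  | |- PR (fun p n => codecons (@?t p n) (@?u p n)) => apply (@PR_codecons t u)
  | |- PR (fun p n => nat_of_bool (odd (@?t p n))) => apply (@PR_odd t)
  | |- PR (fun p n => nat_of_bool (leq (@?t p n) (@?u p n))) => apply (@PR_leq t u)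
  | |- PR (fun p n => nat_of_bool (eq_op (@?t p n) (@?u p n))) => apply (@PR_eqn t u)
  | |- PR (fun p n => nat_of_bool (negb (@?b p n))) => apply (@PR_negb b)
  | |- PR (fun p n => nat_of_bool (andb (@?b p n) (@?c p n))) => apply (@PR_andb b c)
  | |- PR (fun p n => nat_of_bool (orb (@?b p n) (@?c p n))) => apply (@PR_orb b c)
  | |- PR (fun p n => nat_of_bool (prefix (decode (@?t p n)) (decode (@?u p n)))) =>
      apply (@PR_prefix t u)
  | |- PR (fun p n => nat_of_bool (all (@?b p n) (iota 0 (@?k p n)))) =>
      apply (@PR_all b k)
  | |- PR (fun p n => nat_of_bool (has (@?b p n) (iota 0 (@?k p n)))) =>
      apply (@PR_has b k)
  | |- PR (fun p n => nth 0 (decode (@?t p n)) (@?u p n)) => apply (@PR_nth t u)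
  | |- PR (fun p n => size (decode (@?t p n))) => apply (@PR_size t)
  | |- PR (fun p n => code (mkseq (@?X p n) (@?k p n))) => apply (@PR_mkseq X k)
  | |- PR (fun p n => code (take (@?u p n) (decode (@?t p n)))) =>
      apply (@PR_take t u)
  | |- PR (fun p n => prec (@?a p n) (@?b p n) (@?k p n)) => apply (@PR_rec a b k)
  | |- PR (fun p n => match _ with true => _ | false => _ end) => apply: PR_if
  | |- PR _ => first [assumption | apply: PR_const]
  end.
Ltac pr := repeat (cbv beta; pr1).

(** * Finite use of the oracle *)

Lemma PR_cont F : PR F -> forall p n, exists k, forall p' : baire,
  (forall i, i < k -> p' i = p i) -> F p' n = F p n.
Proof.
elim=> {F} [|||||A B _ IA _ IB|A B _ IA _ IB|A B _ IA _ IB] p n;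
  try by exists 0.
- by exists n.+1 => p' /(_ n (ltnSn n)).
- have [k kP] := IA p n; have [l lP] := IB p n; exists (maxn k l) => p' pp'.
  by rewrite kP ?lP // => i lti; apply: pp'; rewrite leq_max lti ?orbT.
- have [l lP] := IB p n; have [k kP] := IA p (B p n); exists (maxn k l) => p' pp'.
  by rewrite lP ?kP // => i lti; apply: pp'; rewrite leq_max lti ?orbT.
- elim: (sndn n) => [|j [l IHl]] /=; first exact: IA.
  set r := prec _ _ j in IHl *.
  have [k kP] := IB p (pairn (fstn n) (pairn j r)); exists (maxn k l) => p' pp'.
  by rewrite IHl ?kP // => i lti; apply: pp'; rewrite leq_max lti ?orbT.
Qed.

(* [F (interleave p f)] run with only the finite part [s] of [f]: the value 0
   means that the computation asked for an unknown value of [f], and [y.+1]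
   that it returned [y]. *)
Definition finite_use F S := [/\ PR S,
  forall (p f : baire) k x y, S p (pairn (code (mkseq f k)) x) = y.+1 ->
    F (interleave p f) x = y &
  forall (p f : baire) x, exists N, forall k, N <= k ->
    S p (pairn (code (mkseq f k)) x) = (F (interleave p f) x).+1].

Lemma finite_use_local (g : nat -> nat) : PR (fun _ n => g n) ->
  finite_use (fun _ n => g n) (fun _ n => (g (sndn n)).+1).
Proof.
move=> gP; split.
- exact: PR_S (PR_comp gP PR_snd).
- by move=> p f k x y; rewrite sndnK => -[].
- by move=> p f x; exists 0 => k _; rewrite sndnK.
Qed.

(** Structural induction: an unknown value met in a subcomputation propagates as 0, and known values
    are shifted back before use. *)
Lemma PR_finite_use F : PR F -> exists S, finite_use F S.
Proof.
elim=> {F} [|||||A B _ [SA [SAP A1 A2]] _ [SB [SBP B1 B2]]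
  |A B _ [SA [SAP A1 A2]] _ [SB [SBP B1 B2]]
  |A B _ [SA [SAP A1 A2]] _ [SB [SBP B1 B2]]].
- by eexists; apply: finite_use_local PR_zero.
- by eexists; apply: finite_use_local PR_succ.
- by eexists; apply: finite_use_local PR_fst.
- by eexists; apply: finite_use_local PR_snd.
(* Odd queries to [interleave p f] go to [f] and are answered only inside its known part. *)
- exists (fun p n => if odd (sndn n) then
    if (sndn n)./2 < size (decode (fstn n))
    then (nth 0 (decode (fstn n)) (sndn n)./2).+1 else 0
    else (p (sndn n)./2).+1); split.
  + by pr.
  + move=> p f k x y; rewrite fstnK sndnK CodeSeq.codeK size_mkseq /interleave.
    by case: odd => [|[//]]; case: ltnP => // ltk; rewrite nth_mkseq // => -[].
  + move=> p f x; exists x.+1 => k xk.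
    rewrite fstnK sndnK CodeSeq.codeK size_mkseq /interleave; case: odd => //.
    have ltk : x./2 < k by apply: leq_trans xk; rewrite ltnS leq_half_double; lia.
    by rewrite ltk nth_mkseq.
- exists (fun p n => if (SA p n == 0) || (SB p n == 0) then 0
                     else (pairn (SA p n).-1 (SB p n).-1).+1); split.
  + by pr.
  + move=> p f k x y; case Ea: SA => [|a]; case Eb: SB => [|b] //= [<-].
    by rewrite (A1 _ _ _ _ _ Ea) (B1 _ _ _ _ _ Eb).
  + move=> p f x; have [Na NaP] := A2 p f x; have [Nb NbP] := B2 p f x.
    by exists (maxn Na Nb) => k; rewrite geq_max => /andP[/NaP -> /NbP ->].
- exists (fun p n => if SB p n == 0 then 0
                     else SA p (pairn (fstn n) (SB p n).-1)); split.
  + pr => //; apply: PR_comp SAP _; pr.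
  + move=> p f k x y; rewrite fstnK; case Eb: SB => [|b] //= Ea.
    by rewrite (B1 _ _ _ _ _ Eb) (A1 _ _ _ _ _ Ea).
  + move=> p f x; have [Nb NbP] := B2 p f x.
    have [Na NaP] := A2 p f (B (interleave p f) x).
    exists (maxn Na Nb) => k; rewrite geq_max => /andP[ak bk].
    by rewrite NbP //= fstnK NaP.
- exists (fun p n => prec (SA p (pairn (fstn n) (fstn (sndn n))))
    (fun i r => if r == 0 then 0 else
      SB p (pairn (fstn n) (pairn (fstn (sndn n)) (pairn i r.-1))))
    (sndn (sndn n))); split.
  + pr; [apply: PR_comp SAP _|apply: PR_comp SBP _]; pr.
  + move=> p f k x; rewrite fstnK sndnK; elim: (sndn x) => [|j IH] y /=.
      exact: A1.
    by case Er: prec (IH) => [|r] // /(_ _ erefl) -> /B1.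
  + move=> p f x; suff [N NP] : exists N, forall k, N <= k ->
        prec (SA p (pairn (code (mkseq f k)) (fstn x)))
          (fun i r => if r == 0 then 0 else
            SB p (pairn (code (mkseq f k)) (pairn (fstn x) (pairn i r.-1))))
          (sndn x) =
        (prec (A (interleave p f) (fstn x)) (fun i r =>
          B (interleave p f) (pairn (fstn x) (pairn i r))) (sndn x)).+1.
      by exists N => k /NP; rewrite fstnK sndnK.
    elim: (sndn x) => [|j [N NP]] /=; first exact: A2.
    set r := prec _ _ j in NP *.
    have [M MP] := B2 p f (pairn (fstn x) (pairn j r)).
    by exists (maxn N M) => k; rewrite geq_max => /andP[/NP -> /MP <-].
Qed.

(** * Sigma-1-1 predicates *)

(** Kleene's normal form of a lightface Sigma-1-1 predicate: one function quantifier followed by one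
    number quantifier, uniformly in the oracle [p]. *)
Definition S11 (P : baire -> nat -> Prop) : Prop :=
  exists2 F, PR F & forall p n, P p n <->
    exists f : baire, forall m, F (interleave p f) (pairn n m) = 0.

Lemma S11_eq (P Q : baire -> nat -> Prop) :
  (forall p n, P p n <-> Q p n) -> S11 P -> S11 Q.
Proof. by move=> PQ [F FP FE]; exists F => // p n; rewrite -PQ. Qed.

(** The tree of attempts at a function witness: a node is kept as long as no computation on its
    finite information has returned a nonzero value, so the paths are the witnesses. *)
Theorem S11_tree P : S11 P -> exists2 tr, PR tr & forall p n,
  exists2 T : tree, tree_names (fun s => tr p (pairn n s)) T &
    (P p n <-> ~ well_founded_tree T).
Proof.
move=> [F /PR_finite_use [S [SP S1 S2]] FE].
(* A value at most 1 is either undecided or a computed 0. Testing all prefixes, each with finitely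
   many [m], makes the condition decidable and closed under prefixes. *)
pose ok p n s := all (fun k => all (fun m =>
  S p (pairn (code (take k s)) (pairn n m)) <= 1) (iota 0 k)) (iota 0 (size s).+1).
have okP p n s : reflect (forall k m, k <= size s -> m < k ->
    S p (pairn (code (take k s)) (pairn n m)) <= 1) (ok p n s).
  apply: (iffP allP) => [H k m ks mk|H k].
    have /allP : all (fun m => S p (pairn (code (take k s)) (pairn n m)) <= 1)
      (iota 0 k) by apply: H; rewrite mem_iota.
    by apply; rewrite mem_iota.
  by rewrite mem_iota ltnS => ks; apply/allP => m; rewrite mem_iota; apply: H.
have ok0 p n : ([set s | ok p n s] !=set0)%classic.
  by exists [::]; apply/okP => -[].
have okpre p n s t : prefix s t -> ok p n t -> ok p n s.
  move=> /prefixP [u ->] /okP H; apply/okP => k m ks mk.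
  have ksu : k <= size (s ++ u) by rewrite size_cat; apply: leq_trans ks (leq_addr _ _).
  have := H k m ksu mk; rewrite take_cat.
  by case: ltnP => // sk; have -> : k = size s by [apply/eqP; rewrite eqn_leq ks];
    rewrite subnn take0 cats0 take_size.
exists (fun p c => ok p (fstn c) (decode (sndn c))).
  rewrite /ok; pr; apply: PR_comp SP _; pr.
move=> p n; exists (Tree (ok0 p n) (okpre p n)).
  by move=> s; rewrite fstnK sndnK CodeSeq.codeK /= asboolb.
rewrite FE; split=> [[f fP] wf|nwf].
  suff : paths (Tree (ok0 p n) (okpre p n)) f by rewrite wf.
  move=> k /=; apply/okP => l m; rewrite size_mkseq => lk ml.
  have -> : take l (mkseq f k) = mkseq f l.
    by rewrite /mkseq -map_take take_iota (minn_idPl lk).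
  by case E: S => [//|y]; rewrite -(S1 _ _ _ _ _ E) fP.
have [f fP] : exists f, paths (Tree (ok0 p n) (okpre p n)) f.
  apply: contrapT => nf; apply: nwf; apply/seteqP; split=> // f fP.
  by apply: nf; exists f.
exists f => m; have [N NP] := S2 p f (pairn n m).
(* At length [K] the computation has converged and [m] is among the tested instances. *)
pose K := maxn N m.+1.
have /okP /(_ K m) := fP K; rewrite size_mkseq leqnn take_oversize ?size_mkseq //.
by rewrite NP ?leq_maxl // leq_maxr => /(_ isT isT); lia.
Qed.

Definition D11 P := S11 P /\ S11 (fun p n => ~ P p n).

Lemma S11_D P : D11 P -> S11 P. Proof. by case. Qed.

Lemma S11_bool (b : baire -> nat -> bool) : PR (fun p n => b p n : nat) ->
  S11 (fun p n => b p n).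
Proof.
move=> bP; exists (fun p c => ~~ b (evens p) (fstn c)).
  apply: PR_negb; exact: (PR_subst bP (PB_evens PB_id) PR_fst).
move=> p n; split=> [bpn|[f /(_ 0)]]; last first.
  by rewrite evens_interleave fstnK; case: (b p n).
by exists p => m; rewrite evens_interleave fstnK bpn.
Qed.

Lemma D11_bool (b : baire -> nat -> bool) : PR (fun p n => b p n : nat) ->
  D11 (fun p n => b p n).
Proof.
move=> bP; split; first exact: S11_bool.
apply: S11_eq (S11_bool (PR_negb bP)) => p n; split=> [/negP//|H]; exact/negP.
Qed.

Lemma D11_eqn t u : PR t -> PR u -> D11 (fun p n => t p n = u p n).
Proof.
move=> tP uP; have [H1 H2] := D11_bool (PR_eqn tP uP).
split; [apply: S11_eq H1|apply: S11_eq H2] => p n; first by split=> /eqP.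
by split=> H E; apply: H; apply/eqP.
Qed.

Lemma S11_and P Q : S11 P -> S11 Q -> S11 (fun p n => P p n /\ Q p n).
Proof.
move=> [F FP FE] [G GP GE].
exists (fun p c => F (interleave (evens p) (evens (odds p))) c +
                   G (interleave (evens p) (odds (odds p))) c).
  by apply: PR_add; apply: PR_subst PR_id => //; pr.
move=> p n; rewrite FE GE; split=> [[[f fP] [g gP]]|[h hP]].
  exists (interleave f g) => m.
  by rewrite !(evens_interleave, odds_interleave) fP gP.
by split; [exists (evens h)|exists (odds h)] => m; move: (hP m);
  rewrite !(evens_interleave, odds_interleave) => /eqP;
  rewrite addn_eq0 => /andP[/eqP ? /eqP].
Qed.

Lemma S11_or P Q : S11 P -> S11 Q -> S11 (fun p n => P p n \/ Q p n).
Proof.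
move=> [F FP FE] [G GP GE].
(* All the products [F i * G j] vanish iff [F] or [G] vanishes identically. *)
exists (fun p c =>
  F (interleave (evens p) (evens (odds p))) (pairn (fstn c) (fstn (sndn c))) *
  G (interleave (evens p) (odds (odds p))) (pairn (fstn c) (sndn (sndn c)))).
  by apply: PR_mul; apply: PR_subst => //; pr.
move=> p n; rewrite FE GE; split=> [[[f fP]|[f fP]]|[h hP]].
- exists (interleave f f) => m.
  by rewrite !(evens_interleave, odds_interleave, fstnK) fP.
- exists (interleave f f) => m.
  by rewrite !(evens_interleave, odds_interleave, fstnK) fP muln0.
- apply: contrapT => /not_orP [nF nG].
  have /existsNP [i /eqP ni] : ~ forall i, F (interleave p (evens h)) (pairn n i) = 0.
    by move=> H; apply: nF; exists (evens h).
  have /existsNP [j /eqP nj] : ~ forall i, G (interleave p (odds h)) (pairn n i) = 0.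
    by move=> H; apply: nG; exists (odds h).
  have /eqP := hP (pairn i j).
  rewrite !(evens_interleave, odds_interleave, fstnK, sndnK) muln_eq0.
  by rewrite (negbTE ni) (negbTE nj).
Qed.

Lemma S11_subst P G t : S11 P -> PB G -> PR t ->
  S11 (fun p n => P (G p n) (t p n)).
Proof.
move=> [F FP FE] GP tP.
exists (fun p c => F (interleave (G (evens p) (fstn c)) (odds p))
                     (pairn (t (evens p) (fstn c)) (sndn c))).
  apply: PR_subst => //; last by pr; apply: (PR_subst tP); pr.
  apply: PB_interleave; last by pr.
  by apply: PR_eq (PR_subst GP (G := fun p n => evens p) (t := fun p n => pairn (fstn (fstn n)) (sndn n)) _ _) => [p n||]; rewrite ?fstnK ?sndnK //; pr.
move=> p n; rewrite FE; split=> -[f fP]; exists f => m; move: (fP m);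
  by rewrite !(evens_interleave, odds_interleave, fstnK, sndnK).
Qed.

Lemma S11_ex (Q : baire -> nat -> nat -> Prop) :
  S11 (fun p n => Q p (fstn n) (sndn n)) -> S11 (fun p n => exists k, Q p n k).
Proof.
move=> [F FP FE].
(* The number witness is stored as the value at 0 of the second half of the function witness. *)
exists (fun p c => F (interleave (evens p) (evens (odds p)))
  (pairn (pairn (fstn c) (odds (odds p) 0)) (sndn c))).
  by apply: PR_subst => //; pr.
move=> p n; split=> [[k]|[f fP]].
  have := FE p (pairn n k); rewrite fstnK sndnK => -> [f fP].
  exists (interleave f (fun=> k)) => m.
  by rewrite !(evens_interleave, odds_interleave, fstnK, sndnK).
exists (odds f 0); have := FE p (pairn n (odds f 0)).
rewrite fstnK sndnK => ->; exists (evens f) => m.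
by have := fP (pairn n m); rewrite !(evens_interleave, odds_interleave, fstnK, sndnK);
  have := fP m; rewrite !(evens_interleave, odds_interleave, fstnK, sndnK).
Qed.

(** Countable choice: the witnesses for all [k] become the columns of one function. *)
Lemma S11_all (Q : baire -> nat -> nat -> Prop) :
  S11 (fun p n => Q p (fstn n) (sndn n)) -> S11 (fun p n => forall k, Q p n k).
Proof.
move=> [F FP FE].
exists (fun p c => F
  (interleave (evens p) (fun i => odds p (pairn (fstn (sndn c)) i)))
  (pairn (pairn (fstn c) (fstn (sndn c))) (sndn (sndn c)))).
  apply: (PR_subst FP); last by pr.
  by apply: PB_interleave; rewrite /PB; pr.
move=> p n; split=> [H|[f fP] k]; last first.
  have := FE p (pairn n k); rewrite fstnK sndnK => ->.
  exists (fun i => f (pairn k i)) => m.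
  by have := fP (pairn k m); rewrite !(evens_interleave, odds_interleave, fstnK, sndnK).
have /choice [f fP] : forall k, exists f : baire, forall m,
    F (interleave p f) (pairn (pairn n k) m) = 0.
  by move=> k; apply/FE; rewrite fstnK sndnK.
exists (fun c => f (fstn c) (sndn c)) => m.
rewrite !(evens_interleave, odds_interleave, fstnK, sndnK) -[RHS](fP (fstn m) (sndn m)).
by congr (F (interleave _ _) _); apply: funext => i; rewrite fstnK sndnK.
Qed.

Lemma S11_exfun (Q : baire -> baire -> nat -> Prop) :
  S11 (fun p n => Q (evens p) (odds p) n) ->
  S11 (fun p n => exists f, Q p f n).
Proof.
move=> [F FP FE].
exists (fun p c => F (interleave (interleave (evens p) (evens (odds p)))
                        (odds (odds p))) c).
  by apply: PR_subst => //; pr.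
move=> p n; split=> [[g]|[h hP]].
  have := FE (interleave p g) n; rewrite evens_interleave odds_interleave => ->.
  by move=> [f fP]; exists (interleave g f) => m;
    rewrite !(evens_interleave, odds_interleave).
exists (evens h); have := FE (interleave p (evens h)) n.
rewrite evens_interleave odds_interleave => ->; exists (odds h) => m.
by have := hP m; rewrite !(evens_interleave, odds_interleave).
Qed.

Lemma D11_not P : D11 P -> D11 (fun p n => ~ P p n).
Proof.
move=> [H1 H2]; split=> //; apply: S11_eq H1 => p n.
by split=> [H nH|/contrapT]; [apply: nH|].
Qed.

Lemma D11_and P Q : D11 P -> D11 Q -> D11 (fun p n => P p n /\ Q p n).
Proof.
move=> [P1 P2] [Q1 Q2]; split; first exact: S11_and.
apply: S11_eq (S11_or P2 Q2) => p n; split=> [[?|?] []//|].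
by move=> /not_andP.
Qed.

Lemma D11_imp P Q : D11 P -> D11 Q -> D11 (fun p n => P p n -> Q p n).
Proof.
move=> [P1 P2] [Q1 Q2]; split.
  apply: S11_eq (S11_or P2 Q1) => p n; split=> [[]//|H].
  by have [/H|] := pselect (P p n); [right|left].
apply: S11_eq (S11_and P1 Q2) => p n; split=> [[? nQ] /(_ _)|/not_implyP//].
by move=> H; apply: nQ; apply: H.
Qed.

Lemma D11_ex (Q : baire -> nat -> nat -> Prop) :
  D11 (fun p n => Q p (fstn n) (sndn n)) -> D11 (fun p n => exists k, Q p n k).
Proof.
move=> [Q1 Q2]; split; first exact: S11_ex.
apply: S11_eq (S11_all (Q := fun p n k => ~ Q p n k) Q2) => p n.
by split=> [H [k]|H k Qk]; [apply: H|apply: H; exists k].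
Qed.

Lemma D11_all (Q : baire -> nat -> nat -> Prop) :
  D11 (fun p n => Q p (fstn n) (sndn n)) -> D11 (fun p n => forall k, Q p n k).
Proof.
move=> [Q1 Q2]; split; first exact: S11_all.
apply: S11_eq (S11_ex (Q := fun p n k => ~ Q p n k) Q2) => p n.
by split=> [[k nQ] H|/existsNP]; first exact: nQ.
Qed.

Lemma S11_imp P Q : D11 P -> S11 Q -> S11 (fun p n => P p n -> Q p n).
Proof.
move=> [_ P2] Q1; apply: S11_eq (S11_or P2 Q1) => p n; split=> [[]//|H].
by have [/H|] := pselect (P p n); [right|left].
Qed.

Lemma S11_app2 (P : baire -> nat -> nat -> Prop) G t u :
  S11 (fun p n => P p (fstn n) (sndn n)) -> PB G -> PR t -> PR u ->
  S11 (fun p n => P (G p n) (t p n) (u p n)).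
Proof.
move=> PP GP tP uP; apply: S11_eq (S11_subst PP GP (PR_pair tP uP)) => p n.
by rewrite fstnK sndnK.
Qed.

(** * Simulations *)

(** Stands for an inequality of ranks, that of [x] being at most that of [y]: a step lowers the
    rank, and a nonterminating element has infinite rank. *)
Definition sim (X Y : Type) (R : X -> X -> Prop) (S : Y -> Y -> Prop) x y :=
  exists2 E : X -> Y -> Prop, E x y &
    forall a b, E a b -> forall a', R a a' -> exists2 b', S b b' & E a' b'.

(** [Acc] descends to predecessors, while [R a b] is a step from [a] to [b]; hence the swap. *)
Definition terminates (X : Type) (R : X -> X -> Prop) := Acc (fun b a => R a b).

Section Simulation.
Variables (X Y : Type) (R : X -> X -> Prop) (S : Y -> Y -> Prop).

Lemma sim_step x y x' : sim R S x y -> R x x' -> exists2 y', S y y' & sim R S x' y'.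
Proof. by move=> [E Exy EP] /(EP _ _ Exy) [y' yy' Ey']; exists y' => //; exists E. Qed.

Lemma sim_intro x y :
  (forall x', R x x' -> exists2 y', S y y' & sim R S x' y') -> sim R S x y.
Proof.
move=> H; exists (fun a b => (a = x /\ b = y) \/ sim R S a b); first by left.
move=> a b [[-> ->] a' /H|ab a' /(sim_step ab)] [b' bb' Hb'];
  by exists b' => //; right.
Qed.

Lemma sim_terminates x y : sim R S x y -> terminates S y -> terminates R x.
Proof.
move=> xy yT; elim: yT x xy => {}y _ IH x xy; constructor => x' /(sim_step xy) [y' yy' s].
exact: IH yy' _ s.
Qed.

End Simulation.

(** Comparability of ranks: the second alternative says that [y] has smaller rank than [x], as some
    step from [x] still dominates it. *)
Lemma sim_total (X Y : Type) (R : X -> X -> Prop) (S : Y -> Y -> Prop) x :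
  terminates R x -> forall y,
  sim R S x y \/ exists2 x', R x x' & sim S R y x'.
Proof.
elim=> {}x _ IH y; have [|nH] := pselect (exists2 x', R x x' & sim S R y x').
  by right.
left; apply: sim_intro => x' xx'; apply: contrapT => nH'.
apply: nH; exists x' => //; apply: sim_intro => y' yy'.
have [xy'|[x'' ? ?]] := IH x' xx' y'; last by exists x''.
by case: nH'; exists y'.
Qed.

Lemma sim_trans (X Y Z : Type) (R : X -> X -> Prop) (S : Y -> Y -> Prop)
  (U : Z -> Z -> Prop) x y z : sim R S x y -> sim S U y z -> sim R U x z.
Proof.
move=> xy yz; exists (fun a c => exists2 b, sim R S a b & sim S U b c).
  by exists y.
move=> a c [b ab bc] a' /(sim_step ab) [b' /(sim_step bc) [c' cc' ?] ?].
by exists c' => //; exists b'.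
Qed.

(** Ranks drop strictly along a step: otherwise the step from [x] to [x'] would be copied at [x'],
    and so on without end. *)
Lemma terminates_progress (X : Type) (R : X -> X -> Prop) x x' :
  terminates R x -> R x x' -> sim R R x x' -> False.
Proof.
move=> xT; elim: xT x' => {}x _ IH x' xx' s.
have [x'' x'x'' s'] := sim_step s xx'.
exact: IH xx' _ x'x'' s'.
Qed.

Lemma nonterminating_chain (X : Type) (R : X -> X -> Prop) x : ~ terminates R x ->
  exists2 f : nat -> X, f 0 = x & forall i, R (f i) (f i.+1).
Proof.
move=> nx; pose Y := {x | ~ terminates R x}.
have next (y : Y) : exists z : Y, R (sval y) (sval z).
  case: y => y ny /=; apply: contrapT => nz; apply: ny; constructor => z yz.
  by apply: contrapT => nzT; apply: nz; exists (exist _ z nzT).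
have [g gP] := choice next.
by exists (fun i => sval (iter i g (exist _ x nx))).
Qed.

(** * Scattered nodes of a tree *)

Definition incomp (s t : seq nat) := ~~ prefix s t && ~~ prefix t s.

Lemma incomp_sym s t : incomp s t = incomp t s.
Proof. by rewrite /incomp andbC. Qed.

Lemma prefix_mkseq (x : baire) m n : m <= n -> prefix (mkseq x m) (mkseq x n).
Proof.
by move=> mn; rewrite prefixE size_mkseq /mkseq -map_take take_iota (minn_idPl mn).
Qed.

Lemma prefix_mkseqE (x : baire) s n : prefix s (mkseq x n) -> s = mkseq x (size s).
Proof.
move=> sx; have := size_prefix sx; rewrite size_mkseq => le.
move: sx; rewrite prefixE => /eqP {1}<-.
by rewrite /mkseq -map_take take_iota (minn_idPl le).
Qed.

Lemma incompN s t : ~~ incomp s t -> prefix s t \/ prefix t s.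
Proof. by rewrite /incomp negb_and !negbK => /orP. Qed.

Lemma prefix_size_eq (s t : seq nat) : prefix s t -> size t <= size s -> s = t.
Proof. by rewrite prefixE => /eqP {2}<- /take_oversize. Qed.

Lemma mkseq_incomp (x y : baire) n : mkseq x n <> mkseq y n ->
  incomp (mkseq x n) (mkseq y n).
Proof.
move=> H; apply/andP; split; apply/negP => /prefix_size_eq;
  rewrite !size_mkseq => /(_ (leqnn _)) //.
by move=> E; apply: H; rewrite E.
Qed.

Lemma chain_limit (f : nat -> seq nat) : (forall i, prefix (f i) (f i.+1)) ->
  (forall i, size (f i) < size (f i.+1)) ->
  exists x : baire, forall i, f i = mkseq x (size (f i)).
Proof.
move=> fpre fsz; have lt i : i <= size (f i).
  by elim: i => // i IH; apply: leq_ltn_trans IH _.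
have pre i k : i <= k -> prefix (f i) (f k).
  move=> /subnKC <-; elim: (k - i) => [|j IH]; first by rewrite addn0 prefix_refl.
  by rewrite addnS; apply: prefix_trans IH (fpre _).
have nthE i k n : n < size (f i) -> i <= k -> nth 0 (f i) n = nth 0 (f k) n.
  by move=> ni /pre /prefixP [u ->]; rewrite nth_cat ni.
(* Entry [n] is read off [f n.+1], whose length exceeds [n]. *)
exists (fun n => nth 0 (f n.+1) n) => i.
apply: (@eq_from_nth _ 0); rewrite ?size_mkseq // => n ltn.
rewrite nth_mkseq //; have [le|/ltnW le] := leqP i n.+1; first exact: nthE.
exact: esym (nthE n.+1 i n (lt n.+1) le).
Qed.


Section Scattered.
Variable T : set (seq nat).

(** An infinite chain of refinements starting at [[:: t]] contains a Cantor scheme above [t]. *)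
Definition refines (A B : seq (seq nat)) :=
  (forall s, s \in B -> T s) /\
  forall s, s \in A -> exists s0 s1, [/\ s0 \in B, s1 \in B, prefix s s0,
    prefix s s1 & incomp s0 s1].

Definition child (s t : seq nat) := T t /\ exists j, t = rcons s j.

(* The rank of [(m, L)] is [omega * rank L + m]. *)
Definition omega (a b : nat * seq (seq nat)) :=
  (a.1 = b.1.+1 /\ a.2 = b.2) \/ refines a.2 b.2.

Definition scattered t := terminates refines [:: t].
(** Despite its name this also holds of every [t] that is not scattered, see [pathlessP]. *)
Definition pathless t := exists m, sim child omega t (m, [:: t]).

Lemma refines_cat A B A' B' : refines A A' -> refines B B' ->
  refines (A ++ B) (A' ++ B').
Proof.
move=> [AT AP] [BT BP]; split=> s; rewrite mem_cat => /orP[].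
- exact: AT.
- exact: BT.
- move=> /AP [s0 [s1 [i0 i1 ? ? ?]]]; exists s0, s1.
  by split=> //; rewrite mem_cat (i0, i1).
- move=> /BP [s0 [s1 [i0 i1 ? ? ?]]]; exists s0, s1.
  by split=> //; rewrite mem_cat (i0, i1) orbT.
Qed.

(** Two levels are refined side by side, so the rank of [B ++ C] is at least the minimum of the two
    ranks. *)
Lemma sim_cat A B C : sim refines refines A B -> sim refines refines A C ->
  sim refines refines A (B ++ C).
Proof.
move=> AB AC.
exists (fun A D => exists B C, [/\ D = B ++ C, sim refines refines A B &
   sim refines refines A C]); first by exists B, C.
move=> {AB AC}{}A _ [{}B [{}C [-> AB AC]]] A' AA'.
have [B' BB' ?] := sim_step AB AA'; have [C' CC' ?] := sim_step AC AA'.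
by exists (B' ++ C'); [exact: refines_cat|exists B', C'].
Qed.

(** A refinement of [[:: t]] also refines [[:: s]], so ranks do not increase along extensions. *)
Lemma sim_prefix s t : prefix s t -> sim refines refines [:: t] [:: s].
Proof.
move=> st; apply: sim_intro => B [BT /(_ _ (mem_head _ _)) [s0 [s1 [? ? t0 t1 ?]]]].
exists B; last by exists eq => // a _ <- a' ?; exists a'.
split=> // u; rewrite inE => /eqP ->; exists s0, s1.
by split=> //; apply: prefix_trans st _.
Qed.

Lemma refines_pair t u v : T u -> T v -> prefix t u -> prefix t v -> incomp u v ->
  refines [:: t] [:: u; v].
Proof.
move=> Tu Tv tu tv uv; split=> s.
  by rewrite !inE => /orP[] /eqP ->.
by rewrite inE => /eqP ->; exists u, v; rewrite !inE !eqxx orbT.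
Qed.

(* Two incompatible nodes of the same rank as [t] would raise the rank of [t]. *)
Lemma top_rank_chain L t u v : terminates refines L -> sim refines refines [:: t] L ->
  T u -> T v -> prefix t u -> prefix t v ->
  sim refines refines L [:: u] -> sim refines refines L [:: v] -> ~~ incomp u v.
Proof.
move=> LT tL Tu Tv tu tv Lu Lv; apply/negP => uv.
have [L' LL' s] := sim_step tL (refines_pair Tu Tv tu tv uv).
exact: terminates_progress LT LL' (sim_trans (sim_cat Lu Lv) s).
Qed.

Lemma sim_refl A : sim refines refines A A.
Proof. by exists eq => // a _ <- a' ?; exists a'. Qed.

Lemma scattered_prefix s t : prefix s t -> scattered s -> scattered t.
Proof. by move=> /sim_prefix; exact: sim_terminates. Qed.

(** Some node along [x] has least rank. In place of a least ordinal, the induction lowers a level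
    [L] that bounds the rank of the current node. *)
Lemma top_rank_exists (x : baire) n : scattered (mkseq x n) ->
  exists m, forall k, sim refines refines [:: mkseq x m] [:: mkseq x k].
Proof.
move=> nT; suff H L : terminates refines L -> forall n,
    sim refines refines [:: mkseq x n] L ->
    exists m, forall k, sim refines refines [:: mkseq x m] [:: mkseq x k].
  exact: H nT n (sim_refl _).
elim=> {nT n}{}L LT IH n s.
have [H|/existsNP [k nk]] := pselect (forall k, sim refines refines
    [:: mkseq x n] [:: mkseq x k]); first by exists n.
have [Lk|[L' LL' kL']] := @sim_total _ _ refines refines L (Acc_intro _ LT) [:: mkseq x k].
  by case: nk; apply: sim_trans s Lk.
exact: IH LL' k kL'.
Qed.

(** Outer induction on [L], inner induction on [v]. By [top_rank_chain] at most one child of [v] has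
    the rank of [L]; the inner induction covers it, and the outer one covers the other children. *)
Lemma pathless_rank L : terminates refines L ->
  forall v, terminates child v -> sim refines refines [:: v] L ->
  exists m, sim child omega v (m, L).
Proof.
elim=> {}L LT IHL v vT; elim: vT => {}v vT IHv vL.
have vw w : child v w -> sim refines refines [:: w] L.
  by move=> [_ [j ->]]; apply: sim_trans (sim_prefix (prefix_rcons _ _)) vL.
(* A child of smaller rank moves to a refinement of [L], where the finite part of the rank starts
   anew at some [m']. *)
have off w : child v w -> ~ sim refines refines L [:: w] ->
    forall m, exists2 b, omega (m, L) b & sim child omega w b.
  move=> cw nLw m.
  have [//|[L' LL' wL']] := @sim_total _ _ refines refines L (Acc_intro _ LT) [:: w].
  have [m' ?] := IHL L' LL' w (vT w cw) wL'.
  by exists (m', L') => //; right.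
have [[w cw Lw]|nw] := pselect (exists2 w, child v w & sim refines refines L [:: w]).
  have [m wm] := IHv w cw (vw w cw).
  (* One unit of the finite part pays for the step to [w]. *)
  exists m.+1; apply: sim_intro => u cu.
  have [Lu|nLu] := pselect (sim refines refines L [:: u]); last exact: off.
  exists (m, L); first by left.
  suff -> : u = w by [].
  have [Tw [j Ew]] := cw; have [Tu [i Eu]] := cu.
  have : ~~ incomp u w.
    by apply: (top_rank_chain (Acc_intro _ LT) vL) Lu Lw => //;
      rewrite ?Ew ?Eu prefix_rcons.
  by move=> /incompN [] /prefix_size_eq; rewrite Eu Ew !size_rcons => ->.
exists 0; apply: sim_intro => w cw; apply: off => // Lw.
by apply: nw; exists w.
Qed.

(** A nonterminating level can be refined forever and so answers every step; the finite part 0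
    chosen on the way is arbitrary. *)
Lemma sim_from_nonterminating t L m : ~ terminates refines L ->
  sim child omega t (m, L).
Proof.
move=> nL; exists (fun _ b => ~ terminates refines b.2) => //.
move=> a [m' B] /= nB a' _; apply: contrapT => H; apply: nB; constructor=> B' BB'.
by apply: contrapT => nB'; apply: H; exists (0, B') => //; right.
Qed.

Lemma omega_terminates m L : terminates refines L -> terminates omega (m, L).
Proof.
move=> LT; elim: LT m => {}L _ IH m.
elim: m => [|m IHm]; constructor => -[m' L'] [[/= E1 E2]|/= LL'].
- by [].
- exact: IH.
- by case: E1 => <-; rewrite -E2.
- exact: IH.
Qed.

(** * Branches, the scattered part and the perfect kernel *)

Hypothesis Tpre : forall s t, prefix s t -> T t -> T s.

Lemma nonterminating_child t : T t -> ~ terminates child t ->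
  exists2 x : baire, t = mkseq x (size t) & forall n, T (mkseq x n).
Proof.
move=> Tt nt; have [f f0 fP] := nonterminating_chain nt.
have fE i : exists j, f i.+1 = rcons (f i) j by have [_] := fP i.
have [x xP] : exists x : baire, forall i, f i = mkseq x (size (f i)).
  by apply: chain_limit => i; have [j ->] := fE i;
    rewrite ?prefix_rcons ?size_rcons.
exists x => [|n]; first by rewrite -{1}f0 xP f0.
have fT i : T (f i) by case: i => [|i]; [rewrite f0|have [] := fP i].
have le i : i <= size (f i).
  by elim: i => // i IH; have [j ->] := fE i; rewrite size_rcons.
by apply: Tpre (fT n); rewrite xP prefix_mkseq.
Qed.

Definition branch (x : baire) := forall n, T (mkseq x n).

Lemma branch_child x n : branch x -> ~ terminates child (mkseq x n).
Proof.
move=> xT; move E: (mkseq x n) => s sT.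
elim: sT n E => {}s _ IH n E; apply: (IH (mkseq x n.+1)) (erefl).
by split; [exact: xT|exists (x n); rewrite -E mkseqS].
Qed.

(** For scattered [t] the simulating rank is well-founded, which excludes a branch through [t].
    Conversely, a nonterminating level simulates everything, and otherwise [pathless_rank]
    applies. *)
Lemma pathlessP t : T t ->
  (pathless t <-> ~ (scattered t /\ exists2 x, t = mkseq x (size t) & branch x)).
Proof.
move=> Tt; split=> [[m tm] [st [x tx xT]]|H].
  have := sim_terminates tm (omega_terminates m st).
  by rewrite tx; exact: branch_child.
have [st|nst] := pselect (scattered t); last by exists 0; exact: sim_from_nonterminating.
apply: (pathless_rank st _ (sim_refl _)); apply: contrapT => nt.
by apply: H; split=> //; exact: nonterminating_child nt.
Qed.

Lemma countable_range (A : set baire) : countable A ->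
  exists e : nat -> baire, forall x, A x -> exists i, x = e i.
Proof.
move=> /countable_injP [f fi].
have /choice [e eP] : forall n, exists x : baire, forall y, A y -> f y = n -> x = y.
  move=> n; have [[y Ay fy]|H] := pselect (exists2 y, A y & f y = n).
    by exists y => z Az fz; apply: fi; rewrite ?inE ?fy.
  by exists (fun=> 0) => y Ay fy; case: H; exists y.
by exists e => x Ax; exists (f x); rewrite (eP _ x).
Qed.

Lemma incomp_proper s t u : prefix s t -> incomp t u -> prefix s u -> size s < size t.
Proof.
move=> st tu su; rewrite ltnNge; apply/negP => /(prefix_size_eq st) E.
by move: tu; rewrite /incomp -E su.
Qed.

(** Cantor's diagonal argument: of two incompatible extensions one is off the path [e i], so a
    descent through an infinite refinement would end in a branch through [t] that the enumeration
    misses. *)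
Lemma countable_scattered t (A : set baire) : countable A ->
  (forall x, branch x -> t = mkseq x (size t) -> A x) -> scattered t.
Proof.
move=> /countable_range [e eP] tA; apply: contrapT => nt.
have [L L0 LP] := nonterminating_chain nt.
pose K s := T s /\ exists i, s \in L i.
have K1 s : (exists i, s \in L i) -> forall y : baire,
    exists s', [/\ K s', prefix s s', size s < size s' & s' <> mkseq y (size s')].
  move=> [i si] y; have [LT /(_ s si) [s0 [s1 [i0 i1 p0 p1 s01]]]] := LP i.
  have [E0|n0] := pselect (s0 = mkseq y (size s0)); last first.
    by exists s0; split; [split; [exact: LT|exists i.+1]| |exact: incomp_proper s01 p1|].
  exists s1; split=> //; first by split; [exact: LT|exists i.+1].
    by apply: incomp_proper p1 _ p0; rewrite incomp_sym.
  move=> E1; move: s01; rewrite E0 E1 /incomp.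
  by have [le|/ltnW le] := leqP (size s0) (size s1); rewrite (prefix_mkseq _ le) ?andbF.
have /choice [g gP] : forall c : nat * seq nat, exists s',
    (exists i, c.2 \in L i) -> [/\ K s', prefix c.2 s', size c.2 < size s' &
      s' <> mkseq (e c.1) (size s')].
  move=> [n s]; have [H|H] := pselect (exists i, s \in L i); last by exists s.
  by have [s' ?] := K1 s H (e n); exists s'.
pose f := fix f n := if n is m.+1 then g (m, f m) else t.
have fL n : exists i, f n \in L i.
  elim: n => [|n IH] /=; first by exists 0; rewrite L0 mem_head.
  by have [[]] := gP (n, f n) IH.
have fP n := gP (n, f n) (fL n).
have [x xP] : exists x : baire, forall i, f i = mkseq x (size (f i)).
  by apply: chain_limit => i; have [] := fP i.
have le i : i <= size (f i).
  by elim: i => // i IH; apply: leq_ltn_trans IH _; have [] := fP i.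
have xT : branch x.
  move=> n; apply: (Tpre (t := f n.+1)); last by have [[]] := fP n.
  by rewrite xP prefix_mkseq // ltnW.
have [i xi] := eP x (tA x xT (xP 0)).
by have [_ _ _] := fP i; rewrite -xi; apply; exact: (xP i.+1).
Qed.

(** Initial segments of members of [P] split, as [P] has no isolated points. So a level of such
    nodes always has a refinement of the same kind. *)
Lemma perfect_not_scattered (P : set baire) x n : perfect_set P -> P `<=` branch ->
  P x -> ~ scattered (mkseq x n).
Proof.
move=> [_ limP] PT Px.
have split y k : P y -> exists s0 s1, [/\ exists2 z, P z & s0 = mkseq z (size s0),
    exists2 z, P z & s1 = mkseq z (size s1), prefix (mkseq y k) s0,
    prefix (mkseq y k) s1 & incomp s0 s1].
  move=> Py; have : limit_point P y by rewrite limP.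
  move=> /(_ _ (nbhs_cylinder y k)) [z [/eqP zy Pz /= Ez]].
  have [j zj] : exists j, z j <> y j.
    by apply: contrapT => /forallNP H; apply: zy; apply: funext => j; apply: contrapT.
  pose N := maxn k j.+1; have kN : k <= N by rewrite leq_maxl.
  exists (mkseq y N), (mkseq z N); split.
  - by exists y; rewrite ?size_mkseq.
  - by exists z; rewrite ?size_mkseq.
  - exact: prefix_mkseq.
  - by rewrite -Ez; exact: prefix_mkseq.
  - apply: mkseq_incomp => /mkseq_eqP /(_ j) E.
    by apply: zj; rewrite E // leq_maxr.
have step L : (forall s, s \in L -> exists2 z, P z & s = mkseq z (size s)) ->
    exists2 L', refines L L' & forall s, s \in L' -> exists2 z, P z & s = mkseq z (size s).
  elim: L => [|s L IH] HL; first by exists [::].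
  have [|L' [LT LL'] HL'] := IH; first by move=> u uL; apply: HL; rewrite inE uL orbT.
  have [y Py Es] := HL s (mem_head _ _).
  have [s0 [s1 [H0 H1]]] := split y (size s) Py; rewrite -Es => p0 p1 s01.
  have HP u : u \in [:: s0, s1 & L'] -> exists2 z, P z & u = mkseq z (size u).
    by rewrite !inE => /or3P [/eqP ->|/eqP ->|/HL'].
  exists [:: s0, s1 & L'] => //; split=> u.
    by move=> /HP [z /PT zT ->].
  rewrite inE => /orP[/eqP ->|/LL' [u0 [u1 [i0 i1 ? ? ?]]]].
    by exists s0, s1; rewrite !inE !eqxx orbT.
  by exists u0, u1; rewrite !inE i0 i1 !orbT.
suff H L : terminates refines L ->
    ~ forall s, s \in L -> exists2 z, P z & s = mkseq z (size s).
  by move=> /H; apply => s; rewrite inE => /eqP ->; exists x; rewrite ?size_mkseq.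
by elim=> {}L _ IH /step [L' LL']; exact: IH.
Qed.

Definition scattered_part := [set x | branch x /\ exists n, scattered (mkseq x n)].

(** A branch outside the closed set [P] has a cylinder free of [P], which contains only countably
    many branches, so [countable_scattered] applies. The converse is [perfect_not_scattered]. *)
Lemma kernel_scattered P : is_perfect_kernel branch P -> branch `\` P = scattered_part.
Proof.
move=> [[Pcl Plim] PT PC]; apply/seteqP; split=> x [xT]; last first.
  by move=> [n xn]; split=> // Px; exact: perfect_not_scattered (conj Pcl Plim) PT Px xn.
move=> nPx; split=> //.
have [n nP] : exists n, forall y : baire, mkseq y n = mkseq x n -> ~ P y.
  apply: contrapT => /forallNP H; apply: nPx; apply: (closed_cylinderP Pcl) => n.
  by have /existsNP [y /not_implyP [E /contrapT Py]] := H n; exists y.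
exists n; apply: (countable_scattered PC) => y yT; rewrite size_mkseq => E; split=> //.
exact: nP.
Qed.

Lemma eventually_all (Q : nat -> nat -> Prop) k :
  (forall i, i < k -> exists n, forall m, n <= m -> Q i m) ->
  exists n, forall i m, i < k -> n <= m -> Q i m.
Proof.
elim: k => [|k IH] H; first by exists 0.
have [|n nP] := IH; first by move=> i ik; apply: H; exact: ltnW.
have [n' n'P] := H k (ltnSn k); exists (maxn n n') => i m.
rewrite ltnS geq_max leq_eqVlt => /orP[/eqP ->|ik] /andP[nm n'm]; first exact: n'P.
exact: nP.
Qed.

Definition antichain (l : seq (seq nat)) :=
  forall i j, i < size l -> j < size l -> i != j -> incomp (nth [::] l i) (nth [::] l j).

(** Distinct members of the scattered part separate at a common length at which their nodes are
    scattered. Conversely, each node of the antichain carries a member of its own. *)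
Lemma scattered_part_card k :
  (`I_k #<= scattered_part)%card <->
  exists l, [/\ size l = k, antichain l &
    forall i, i < size l -> T (nth [::] l i) /\ ~ pathless (nth [::] l i)].
Proof.
split=> [/pcard_leP [g]|[l [lk la lT]]].
  have gS i : i < k -> scattered_part (g i) by move=> ik; exact: (@funS _ _ _ _ g i ik).
  have gi i j : i < k -> j < k -> g i = g j -> i = j.
    by move=> ik jk; apply: inj; rewrite inE.
  have [n nP] : exists n, forall i m, i < k -> n <= m ->
      scattered (mkseq (g i) m) /\ forall j, j < k -> i <> j ->
        mkseq (g i) m <> mkseq (g j) m.
    apply: (@eventually_all (fun i m => scattered (mkseq (g i) m) /\
      forall j, j < k -> i <> j -> mkseq (g i) m <> mkseq (g j) m)) => i ik.
    have [gT [a ga]] := gS i ik.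
    have [b bP] : exists b, forall j m, j < k -> b <= m ->
        i <> j -> mkseq (g i) m <> mkseq (g j) m.
      apply: (@eventually_all (fun j m => i <> j -> mkseq (g i) m <> mkseq (g j) m)).
      move=> j jk; have [->|ij] := pselect (i = j); first by exists 0.
      have [c gc] : exists c, g i c <> g j c.
        apply: contrapT => /forallNP H; apply: ij; apply: gi => //.
        by apply: funext => c; exact: contrapT (H c).
      by exists c.+1 => m cm _ /mkseq_eqP /(_ c cm).
    exists (maxn a b) => m; rewrite geq_max => /andP[am bm].
    split; first by apply: scattered_prefix ga; exact: prefix_mkseq.
    by move=> j jk; exact: bP.
  exists (mkseq (fun i => mkseq (g i) n) k); split; first by rewrite size_mkseq.
    move=> i j; rewrite size_mkseq => ik jk /eqP ij; rewrite !nth_mkseq //.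
    have [_ /(_ j jk ij) H] := nP i n ik (leqnn n).
    exact: mkseq_incomp.
  move=> i; rewrite size_mkseq => ik; rewrite nth_mkseq //.
  have [gT _] := gS i ik; have [sc _] := nP i n ik (leqnn n).
  split; first exact: gT.
  move=> /(pathlessP (gT n)); apply; split=> //.
  by exists (g i); rewrite ?size_mkseq.
have /choice [x xP] : forall i, exists x : baire, i < k ->
    nth [::] l i = mkseq x (size (nth [::] l i)) /\ scattered_part x.
  move=> i; have [ik|] := ltnP i k; last by exists (fun=> 0).
  have := lT i; rewrite lk => /(_ ik) [Tl]; rewrite (pathlessP Tl) => /contrapT [sc [x lx xT]].
  by exists x => _; split=> //; split=> //; exists (size (nth [::] l i)); rewrite -lx.
suff /card_le_trans : (`I_k #<= x @` `I_k)%card.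
  apply; apply: subset_card_le => _ [i ik <-]; exact: (xP i ik).2.
rewrite (card_le_eqr (inj_card_eq _)) // => i j; rewrite !inE => ik jk E.
apply/eqP/negPn/negP => ij; have := la i j; rewrite lk => /(_ ik jk ij).
have [-> _] := xP i ik; have [-> _] := xP j jk; rewrite E.
set a := size _; set b := size _.
by rewrite /incomp; have [le|/ltnW le] := leqP a b; rewrite (prefix_mkseq _ le) ?andbF.
Qed.
End Scattered.

(** * Sigma-1-1 descriptions of scatteredness *)

Section Listing.
Variable T : set (seq nat).

(** The path along which the rank of [t] never drops; for scattered [t] the solution lists it at the
    index [code t]. *)
Definition listed (t : seq nat) (x : baire) :=
  [/\ t = mkseq x (size t), branch T x &
      forall k, sim (refines T) (refines T) [:: t] [:: mkseq x k]].

(** Two such paths would separate into incompatible nodes of the rank of [t], against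
    [top_rank_chain]. *)
Lemma listed_unique t x y : scattered T t -> listed t x -> listed t y -> x = y.
Proof.
move=> tT [tx xT xs] [ty yT ys]; apply: contrapT => xy.
have [j xyj] : exists j, x j <> y j.
  apply: contrapT => /forallNP H; apply: xy; apply: funext => j; exact: contrapT (H j).
pose n := maxn (size t) j.+1; have tn : size t <= n by rewrite leq_maxl.
have : incomp (mkseq x n) (mkseq y n).
  by apply: mkseq_incomp => /mkseq_eqP /(_ j) E; apply: xyj; rewrite E // leq_maxr.
apply/negP; apply: (top_rank_chain tT (sim_refl _ _)) => //.
- by rewrite tx; exact: prefix_mkseq.
- by rewrite ty; exact: prefix_mkseq.
Qed.

Lemma listed_scattered t x : scattered T t -> listed t x -> scattered_part T x.
Proof. by move=> tT [tx xT _]; split=> //; exists (size t); rewrite -tx. Qed.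

Lemma scattered_listed x : scattered_part T x ->
  exists2 t, scattered T t & listed t x.
Proof.
move=> [xT [n xn]]; have [m xm] := top_rank_exists xn; exists (mkseq x m).
  exact: sim_terminates (xm n) xn.
by split; rewrite ?size_mkseq.
Qed.

End Listing.

(** Moves a simulation between objects and their codes, so that [S11_sim], which is about numbers,
    applies to nodes and levels. *)
Lemma sim_onto (X Y X' Y' : Type) (R : X -> X -> Prop) (S : Y -> Y -> Prop)
  (f : X' -> X) (f' : X -> X') (g : Y' -> Y) (g' : Y -> Y') x y :
  cancel f' f -> cancel g' g ->
  sim (fun a b => R (f a) (f b)) (fun a b => S (g a) (g b)) x y <->
  sim R S (f x) (g y).
Proof.
move=> fK gK; split=> [[E Exy EP]|[E Exy EP]]; last first.
  exists (fun a b => E (f a) (g b)) => // a b Eab a' Raa'.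
  have [b' Sbb' E'] := EP _ _ Eab _ Raa'.
  by exists (g' b'); rewrite gK.
exists (fun a b => exists a1 b1, [/\ a = f a1, b = g b1 & E a1 b1]).
  by exists x, y.
move=> _ _ [a [b [-> -> Eab]]] a' Raa'.
have [b' Sbb' Eb'] : exists2 b', S (g b) (g b') & E (f' a') b'.
  by apply: EP Eab _ _; rewrite fK.
by exists (g b') => //; exists (f' a'), b'; rewrite fK.
Qed.

Lemma D11_or P Q : D11 P -> D11 Q -> D11 (fun p n => P p n \/ Q p n).
Proof.
move=> [P1 P2] [Q1 Q2]; split; first exact: S11_or.
apply: S11_eq (S11_and P2 Q2) => p n; split=> [[? ?] []//|].
by move=> /not_orP.
Qed.

Lemma D11_eq (P Q : baire -> nat -> Prop) :
  (forall p n, P p n <-> Q p n) -> D11 P -> D11 Q.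
Proof.
by move=> PQ [P1 P2]; split; [apply: S11_eq P1|apply: S11_eq P2] => p n; rewrite PQ.
Qed.

Lemma D11_app2 (P : baire -> nat -> nat -> Prop) G t u :
  D11 (fun p n => P p (fstn n) (sndn n)) -> PB G -> PR t -> PR u ->
  D11 (fun p n => P (G p n) (t p n) (u p n)).
Proof.
move=> [P1 P2] GP tP uP; split; first exact: S11_app2.
exact: (S11_app2 (P := fun p m n => ~ P p m n)).
Qed.

Ltac d1 := lazymatch goal with
  | |- D11 (fun p n => @?P p n /\ @?Q p n) => apply (@D11_and P Q)
  | |- D11 (fun p n => @?P p n \/ @?Q p n) => apply (@D11_or P Q)
  | |- D11 (fun p n => exists k : nat, @?Q p n k) => apply (@D11_ex Q)
  | |- D11 (fun p n => forall k : nat, @?Q p n k) => apply (@D11_all Q)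
  | |- D11 (fun p n => ~ (@?P p n)) => apply (@D11_not P)
  | |- D11 (fun p n => @?P p n -> @?Q p n) => apply (@D11_imp P Q)
  | |- D11 (fun p n => is_true (@?b p n)) => apply (@D11_bool b)
  | |- D11 (fun p n => @eq nat (@?t p n) (@?u p n)) => apply (@D11_eqn t u)
  | |- S11 (fun p n => @?P p n /\ @?Q p n) => apply (@S11_and P Q)
  | |- S11 (fun p n => @?P p n \/ @?Q p n) => apply (@S11_or P Q)
  | |- S11 (fun p n => exists k : nat, @?Q p n k) => apply (@S11_ex Q)
  | |- S11 (fun p n => exists f : baire, @?Q p n f) =>
      apply (@S11_exfun (fun p f n => Q p n f))
  | |- S11 (fun p n => forall k : nat, @?Q p n k) => apply (@S11_all Q)
  | |- S11 (fun p n => @?P p n -> @?Q p n) => apply (@S11_imp P Q)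
  | |- S11 (fun p n => is_true (@?b p n)) => apply (@S11_bool b)
  | |- S11 (fun p n => ~ @eq nat (@?t p n) (@?u p n)) =>
      apply S11_D; apply D11_not; apply (@D11_eqn t u)
  | |- S11 (fun p n => @eq nat (@?t p n) (@?u p n)) => apply S11_D; apply (@D11_eqn t u)
  | _ => pr1
  end.
Ltac d11 := repeat (cbv beta; d1).

(** The simulation relation is itself the function witness, given by the zeros of [E]. As [R] occurs
    in a premise, its complement has to be Sigma-1-1. *)
Lemma S11_sim (R S : baire -> nat -> nat -> Prop) :
  D11 (fun p n => R p (fstn n) (sndn n)) -> D11 (fun p n => S p (fstn n) (sndn n)) ->
  S11 (fun p n => sim (R p) (S p) (fstn n) (sndn n)).
Proof.
move=> RD SD; apply: (@S11_eq (fun p n => exists E : baire, E n = 0 /\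
  forall z, E z = 0 -> forall a', R p (fstn z) a' -> exists b', S p (sndn z) b' /\
    E (pairn a' b') = 0)).
  move=> p n; split=> [[E [En EP]]|[E En EP]].
    exists (fun a b => E (pairn a b) = 0); first by rewrite pairnK.
    move=> a b Eab a' Ra; have := EP _ Eab a'; rewrite fstnK sndnK.
    by move=> /(_ Ra) [b' [? ?]]; exists b'.
  exists (fun z => ~~ `[< E (fstn z) (sndn z) >] : nat); split.
    by rewrite asboolT.
  move=> z; case: asboolP => //= Ez _ a' Ra'; have [b' Sb' Eb'] := EP _ _ Ez _ Ra'.
  by exists b'; split=> //; rewrite fstnK sndnK asboolT.
d11.
- by apply: (D11_app2 (P := R)); d11.
- by apply: S11_D; apply: (D11_app2 (P := S)); d11.
Qed.

(** Defined for every oracle, tree or not, since Sigma-1-1 predicates range over all oracles. *)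
Definition nodes_of (a : baire) : set (seq nat) := [set s | a (code s) = 1].
Definition dlist (m : nat) : seq (seq nat) := map decode (decode m).
Definition clist (L : seq (seq nat)) : nat := code (map code L).

Lemma clistK : cancel clist dlist.
Proof.
by move=> L; rewrite /clist /dlist CodeSeq.codeK -map_comp map_id_in // => s _ /=;
  rewrite CodeSeq.codeK.
Qed.

Lemma dlistK : cancel dlist clist.
Proof.
move=> m; rewrite /clist /dlist -map_comp map_id_in ?CodeSeq.decodeK // => s _ /=.
by rewrite CodeSeq.decodeK.
Qed.

Lemma dlist1 c : dlist (codecons c 0) = [:: decode c].
Proof. by rewrite /dlist codeconsE CodeSeq.codeK. Qed.

Lemma nth_dlist m i : i < size (decode m) ->
  nth [::] (dlist m) i = decode (nth 0 (decode m) i).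
Proof. by move=> im; rewrite (nth_map 0). Qed.

Lemma PR_incomp t u : PR t -> PR u ->
  PR (fun p n => incomp (decode (t p n)) (decode (u p n)) : nat).
Proof. by move=> tP uP; rewrite /incomp; pr. Qed.

Lemma D11_refines :
  D11 (fun a n => refines (nodes_of a) (dlist (fstn n)) (dlist (sndn n))).
Proof.
apply: (@D11_eq (fun a n =>
  (forall i, i < size (decode (sndn n)) -> a (nth 0 (decode (sndn n)) i) = 1) /\
  (forall i, i < size (decode (fstn n)) -> exists i0 i1,
     i0 < size (decode (sndn n)) /\ i1 < size (decode (sndn n)) /\
     prefix (decode (nth 0 (decode (fstn n)) i)) (decode (nth 0 (decode (sndn n)) i0)) /\
     prefix (decode (nth 0 (decode (fstn n)) i)) (decode (nth 0 (decode (sndn n)) i1)) /\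
     incomp (decode (nth 0 (decode (sndn n)) i0)) (decode (nth 0 (decode (sndn n)) i1))))).
  move=> a n; split=> -[H1 H2]; split.
  - move=> s /(nthP [::]) [i]; rewrite size_map => ilt <-.
    by rewrite nth_dlist // /nodes_of /= CodeSeq.decodeK H1.
  - move=> s /(nthP [::]) [i]; rewrite size_map => ilt <-; rewrite nth_dlist //.
    have [i0 [i1 [l0 [l1 [p0 [p1 ic]]]]]] := H2 i ilt.
    exists (nth [::] (dlist (sndn n)) i0), (nth [::] (dlist (sndn n)) i1).
    by split; rewrite ?mem_nth ?size_map ?nth_dlist.
  - move=> i ilt; have := H1 (nth [::] (dlist (sndn n)) i).
    rewrite mem_nth ?size_map // nth_dlist // /nodes_of /= CodeSeq.decodeK.
    exact.
  - move=> i ilt; have := H2 (nth [::] (dlist (fstn n)) i).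
    rewrite mem_nth ?size_map // nth_dlist // => /(_ isT) [s0 [s1 []]].
    move=> /(nthP [::]) [i0]; rewrite size_map => l0 <-.
    move=> /(nthP [::]) [i1]; rewrite size_map => l1 <-.
    by rewrite !nth_dlist // => *; exists i0, i1.
by d11; apply: PR_incomp; pr.
Qed.

Lemma D11_child :
  D11 (fun a n => child (nodes_of a) (decode (fstn n)) (decode (sndn n))).
Proof.
apply: (@D11_eq (fun a n => a (sndn n) = 1 /\
  prefix (decode (fstn n)) (decode (sndn n)) /\
  size (decode (sndn n)) = (size (decode (fstn n))).+1)); last by d11.
move=> a n; rewrite /child /nodes_of /= CodeSeq.decodeK; split=> -[-> H]; split=> //.
  case: H => /prefixP [u ->]; rewrite size_cat -addn1 => /addnI.
  by case: u => [|j []] // _; exists j; rewrite cats1.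
by case: H => j ->; rewrite prefix_rcons size_rcons.
Qed.

Definition dstate (m : nat) := (fstn m, dlist (sndn m)).
Definition cstate (b : nat * seq (seq nat)) := pairn b.1 (clist b.2).

Lemma cstateK : cancel cstate dstate.
Proof. by case=> m L; rewrite /cstate /dstate /= fstnK sndnK clistK. Qed.

Lemma D11_omega :
  D11 (fun a n => omega (nodes_of a) (dstate (fstn n)) (dstate (sndn n))).
Proof.
apply: (@D11_eq (fun a n =>
  (fstn (fstn n) = (fstn (sndn n)).+1 /\ sndn (fstn n) = sndn (sndn n)) \/
  refines (nodes_of a) (dlist (sndn (fstn n))) (dlist (sndn (sndn n))))).
  move=> a n; rewrite /omega /=; split=> -[[-> E]|]; [left|right|left|right] => //.
    by rewrite E.
  by split=> //; exact: can_inj dlistK _ _ E.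
d11; apply: (D11_app2 (P := fun a m n => refines (nodes_of a) (dlist m) (dlist n))
  D11_refines); pr.
Qed.

Lemma S11_pathless : S11 (fun a c => pathless (nodes_of a) (decode c)).
Proof.
apply: (@S11_eq (fun a c => exists m, sim
  (fun s t => child (nodes_of a) (decode s) (decode t))
  (fun b b' => omega (nodes_of a) (dstate b) (dstate b')) c (pairn m (codecons c 0)))).
  move=> a c; suff H m : sim (fun s t => child (nodes_of a) (decode s) (decode t))
      (fun b b' => omega (nodes_of a) (dstate b) (dstate b')) c (pairn m (codecons c 0))
      <-> sim (child (nodes_of a)) (omega (nodes_of a)) (decode c) (m, [:: decode c]).
    by split=> -[m /H]; exists m.
  rewrite (sim_onto _ _ _ _ CodeSeq.codeK cstateK).
  by rewrite /dstate fstnK sndnK dlist1.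
d11; apply: (S11_app2 (P := fun a => sim _ _)
  (S11_sim (R := fun a s t => child (nodes_of a) (decode s) (decode t))
    (S := fun a b b' => omega (nodes_of a) (dstate b) (dstate b'))
    D11_child D11_omega)); pr.
Qed.

Lemma S11_not_scattered : S11 (fun a c => ~ scattered (nodes_of a) (decode c)).
Proof.
apply: (@S11_eq (fun a c => exists f : baire, f 0 = codecons c 0 /\
  forall i, refines (nodes_of a) (dlist (f i)) (dlist (f i.+1)))).
  move=> a c; split=> [[f [f0 fP]] H|nt].
    suff K L : terminates (refines (nodes_of a)) L -> forall i, dlist (f i) <> L.
      by apply: (K _ H 0); rewrite f0 dlist1.
    by elim=> {H}{}L _ IH i E; apply: (IH (dlist (f i.+1)) _ i.+1) => //; rewrite -E.
  have [f f0 fP] := nonterminating_chain nt.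
  exists (fun i => clist (f i)); split=> [|i]; last by rewrite !clistK.
  by rewrite f0; apply: can_inj dlistK _ _ _; rewrite clistK dlist1.
d11; apply: S11_D.
apply: (D11_app2 (P := fun a m n => refines (nodes_of a) (dlist m) (dlist n))
  D11_refines); pr.
Qed.

Lemma S11_listed (P : baire -> baire -> nat -> Prop) :
  S11 (fun p n => P (evens p) (odds p) n) ->
  S11 (fun a n => exists x, listed (nodes_of a) (decode (fstn n)) x /\ P a x n).
Proof.
move=> PS; apply: (@S11_eq (fun a n => exists x : baire,
  (fstn n = code (mkseq x (size (decode (fstn n)))) /\
   (forall k, a (code (mkseq x k)) = 1) /\
   forall k, sim (fun s t => refines (nodes_of a) (dlist s) (dlist t))
                 (fun s t => refines (nodes_of a) (dlist s) (dlist t))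
      (codecons (fstn n) 0) (codecons (code (mkseq x k)) 0)) /\ P a x n)).
  move=> a n; suff H x : (fstn n = code (mkseq x (size (decode (fstn n)))) /\
   (forall k, a (code (mkseq x k)) = 1) /\
   forall k, sim (fun s t => refines (nodes_of a) (dlist s) (dlist t))
                 (fun s t => refines (nodes_of a) (dlist s) (dlist t))
      (codecons (fstn n) 0) (codecons (code (mkseq x k)) 0)) <->
      listed (nodes_of a) (decode (fstn n)) x.
    by split=> -[x [/H]]; exists x.
  have simE k : sim (fun s t => refines (nodes_of a) (dlist s) (dlist t))
                 (fun s t => refines (nodes_of a) (dlist s) (dlist t))
      (codecons (fstn n) 0) (codecons (code (mkseq x k)) 0) <->
      sim (refines (nodes_of a)) (refines (nodes_of a)) [:: decode (fstn n)] [:: mkseq x k].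
    by rewrite (sim_onto _ _ _ _ clistK clistK) !dlist1 CodeSeq.codeK.
  split=> [[E [xT xs]]|[E xT xs]].
    by split=> // [|k]; [rewrite -[RHS]CodeSeq.codeK -E|apply/simE].
  by split; [rewrite -E CodeSeq.decodeK|split=> // k; apply/simE].
d11; last exact: PS.
apply: (S11_app2 (P := fun a => sim (fun s t => refines (nodes_of a) (dlist s) (dlist t))
                 (fun s t => refines (nodes_of a) (dlist s) (dlist t)))
  (S11_sim D11_refines D11_refines)); pr.
Qed.

(** The negation of the criterion in [scattered_part_card], written so that [pathless] occurs
    positively; for trees it says that the scattered part has less than [k] elements. *)
Definition few (T : set (seq nat)) k := forall l, size l = k -> antichain l ->
  exists i, i < size l /\ (T (nth [::] l i) -> pathless T (nth [::] l i)).

Lemma fewP (T : set (seq nat)) k : (forall s t, prefix s t -> T t -> T s) ->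
  few T k <-> ~ (`I_k #<= scattered_part T)%card.
Proof.
move=> Tpre; rewrite (scattered_part_card Tpre); split=> [H [l [lk la lT]]|H l lk la].
  by have [i [il iT]] := H l lk la; have [/iT] := lT i il.
apply: contrapT => /forallNP nl; apply: H; exists l; split=> // i il.
by have /not_andP [/(_ il)|/not_implyP] := nl i.
Qed.

Lemma S11_few : S11 (fun a k => few (nodes_of a) k).
Proof.
apply: (@S11_eq (fun a k => forall l, size (decode l) = k ->
  (forall i j, i < size (decode l) -> j < size (decode l) -> i != j ->
    incomp (decode (nth 0 (decode l) i)) (decode (nth 0 (decode l) j))) ->
  exists i, i < size (decode l) /\
    (a (nth 0 (decode l) i) = 1 -> pathless (nodes_of a) (decode (nth 0 (decode l) i))))).
  move=> a k; suff H l : (size (decode l) = k ->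
    (forall i j, i < size (decode l) -> j < size (decode l) -> i != j ->
      incomp (decode (nth 0 (decode l) i)) (decode (nth 0 (decode l) j))) ->
    exists i, i < size (decode l) /\
      (a (nth 0 (decode l) i) = 1 ->
       pathless (nodes_of a) (decode (nth 0 (decode l) i)))) <->
    (size (dlist l) = k -> antichain (dlist l) -> exists i, i < size (dlist l) /\
      (nodes_of a (nth [::] (dlist l) i) -> pathless (nodes_of a) (nth [::] (dlist l) i))).
    split=> H1 l; last by apply/H; exact: H1.
    by rewrite -[l]clistK; apply/H; exact: H1.
  rewrite size_map; have nE i : i < size (decode l) ->
      a (nth 0 (decode l) i) = a (code (nth [::] (dlist l) i)).
    by move=> il; rewrite nth_dlist // CodeSeq.decodeK.
  split=> H lk la.
    have [|i [il H1]] := H lk.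
      move=> i j il jl ij; rewrite -!nth_dlist //; apply: la; rewrite ?size_map //.
    by exists i; split=> //; rewrite /nodes_of /= -nE // nth_dlist.
  have [|i [il H1]] := H lk.
    move=> i j; rewrite size_map => il jl ij; rewrite !nth_dlist //; exact: la.
  by exists i; split=> //; rewrite nE // -nth_dlist.
d11; first by apply: PR_incomp; pr.
apply: (S11_subst S11_pathless); pr.
Qed.

(** * Programs as Sigma-1-1 predicates *)

(** Induction on the program; the sequence of values in [Rec] becomes a function quantifier. *)
Lemma S11_eval c : S11 (fun p n => eval p c (fstn n) (sndn n)).
Proof.
have app c' : S11 (fun p n => eval p c' (fstn n) (sndn n)) ->
    forall G t u, PB G -> PR t -> PR u ->
    S11 (fun p n => eval (G p n) c' (t p n) (u p n)).
  by move=> H G t u; exact: (S11_app2 (P := fun p => eval p c') H).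
elim: c => [|||||a IHa b IHb|a IHa b IHb|a IHa b IHb|a IHa] /=; try by d11.
- apply: (@S11_eq (fun p n => exists u v, eval p a (fstn n) u /\
    (eval p b (fstn n) v /\ sndn n = pairn u v))).
    by move=> p n; split=> -[u [v]]; [case=> ? []|case]; exists u, v.
  by d11; [apply: (app a)|apply: (app b)] => //; pr.
- apply: (@S11_eq (fun p n => exists u, eval p b (fstn n) u /\ eval p a u (sndn n))).
    by move=> p n; split=> -[u]; [case|]; exists u.
  by d11; [apply: (app b)|apply: (app a)] => //; pr.
- apply: (@S11_eq (fun p n => exists r : baire, eval p a (fstn (fstn n)) (r 0) /\
    ((forall i, i < sndn (fstn n) -> eval p b (pairn (fstn (fstn n)) (pairn i (r i))) (r i.+1))
    /\ sndn n = r (sndn (fstn n))))).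
    by move=> p n; split=> -[r]; [case=> ? []|case]; exists r.
  by d11; [apply: (app a)|apply: (app b)] => //; pr.
- d11; apply: (app a) => //; pr.
Qed.

Lemma eval_fun p c n y y' : eval p c n y -> eval p c n y' -> y = y'.
Proof.
elim: c n y y' => /= [|||||a IHa b IHb|a IHa b IHb|a IHa b IHb|a IHa] n y y';
  try by move=> -> ->.
- move=> [u [v [au bv ->]]] [u' [v' [au' bv' ->]]].
  by rewrite (IHa _ _ _ au au') (IHb _ _ _ bv bv').
- move=> [u bu au] [u' bu' au']; rewrite (IHb _ _ _ bu bu') in au; exact: IHa au au'.
- move=> [r [r0 rS ->]] [r' [r0' rS' ->]].
  suff H i : i <= sndn n -> r i = r' i by apply: H.
  elim: i => [_|i IH lt]; first exact: IHa r0 r0'.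
  have := rS i lt; rewrite IH; last exact: ltnW.
  by move=> /IHb; apply; apply: rS'.
- move=> [ay ly] [ay' ly']; have [lt|lt|//] := ltngtP y y'.
    by have [k] := ly' y lt; move=> /(IHa _ _ _ ay).
  by have [k] := ly y' lt; move=> /(IHa _ _ _ ay').
Qed.

Lemma eval_cont p c n y : eval p c n y -> exists k, forall p' : baire,
  (forall i, i < k -> p' i = p i) -> eval p' c n y.
Proof.
elim: c n y => /= [|||||a IHa b IHb|a IHa b IHb|a IHa b IHb|a IHa] n y;
  try by move=> ->; exists 0.
- by move=> ->; exists n.+1 => p' ->.
- move=> [u [v [/IHa [k kP] /IHb [l lP] ->]]]; exists (maxn k l) => p' pp'.
  exists u, v; split=> //; [apply: kP|apply: lP] => i lti; apply: pp';
    by rewrite leq_max lti ?orbT.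
- move=> [u /IHb [k kP] /IHa [l lP]]; exists (maxn k l) => p' pp'.
  exists u; [apply: kP|apply: lP] => i lti; apply: pp'; by rewrite leq_max lti ?orbT.
- move=> [r [/IHa [k kP] rS ->]].
  have [l lP] : exists l, forall i m, i < sndn n -> l <= m -> forall p' : baire,
      (forall j, j < m -> p' j = p j) ->
      eval p' b (pairn (fstn n) (pairn i (r i))) (r i.+1).
    apply: eventually_all => i /rS /IHb [l lP]; exists l => m lm p' pp'.
    by apply: lP => j jl; apply: pp'; apply: leq_trans lm.
  exists (maxn k l) => p' pp'; exists r; split=> // [|i lti].
    by apply: kP => i lti; apply: pp'; rewrite leq_max lti.
  by apply: lP (leq_maxr k l) _ pp'.
- move=> [/IHa [k kP] aS].
  have [l lP] : exists l, forall i m, i < y -> l <= m -> forall p' : baire,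
      (forall j, j < m -> p' j = p j) -> exists v, eval p' a (pairn n i) v.+1.
    apply: eventually_all => i /aS [v /IHa [l lP]]; exists l => m lm p' pp'; exists v.
    by apply: lP => j jl; apply: pp'; apply: leq_trans lm.
  exists (maxn k l) => p' pp'; split=> [|i lti].
    by apply: kP => i lti; apply: pp'; rewrite leq_max lti.
  by apply: lP (leq_maxr k l) _ pp'.
Qed.

(** * Reduction of ScList *)

(* In case 2, [c = 0] asks whether the scattered part is finite, and [c > 0]
   whether it has less than [c] elements. *)
Definition question (T : set (seq nat)) (n : nat) : Prop :=
  let c := sndn n in
  match fstn n with
  | 0 => ~ scattered T (decode c)
  | 1 => exists x, listed T (decode (fstn c)) x /\ x (fstn (sndn c)) = sndn (sndn c)
  | 2 => exists k, (c = 0 \/ k = c) /\ few T k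
  | _ => exists x, listed T (decode c) x
  end.

Lemma S11_question : S11 (fun a n => question (nodes_of a) n).
Proof.
apply: (@S11_eq (fun a n =>
  (fstn n = 0 /\ ~ scattered (nodes_of a) (decode (sndn n))) \/
  ((fstn n = 1 /\ exists x, listed (nodes_of a) (decode (fstn (sndn n))) x /\
     x (fstn (sndn (sndn n))) = sndn (sndn (sndn n))) \/
  ((fstn n = 2 /\ exists k, (sndn n = 0 \/ k = sndn n) /\ few (nodes_of a) k) \/
  (2 < fstn n /\ exists x, listed (nodes_of a) (decode (sndn n)) x /\ n = n))))).
  move=> a n; rewrite /question; case: (fstn n) => [|[|[|k]]]; split; try by intuition.
  - by case=> [[]|[[]|[[]|[_ [x []]]]]] //; exists x.
  - by case=> x xl; do 3!right; split=> //; exists x.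
have listedS P : S11 (fun p n => P (evens p) (odds p) n) ->
    S11 (fun a n => exists x, listed (nodes_of a) (decode (fstn (sndn n))) x /\
      P a x (sndn n)).
  by move=> PS; apply: (S11_subst (S11_listed PS)); pr.
apply: S11_or; first by d11; apply: (S11_subst S11_not_scattered); pr.
apply: S11_or.
  apply: S11_and; first by d11.
  by apply: (listedS (fun a x c => x (fstn (sndn c)) = sndn (sndn c))); d11.
apply: S11_or; first by d11; apply: (S11_subst S11_few); pr.
apply: S11_and; first by d11.
(* The condition [n = n] and the second component 0 are fillers that bring the last case to the
   shape of [S11_listed]. *)
apply: S11_eq (S11_subst (S11_listed (P := fun _ _ n => n = n) _)
  (G := fun p _ => p) (t := fun p n => pairn (sndn n) 0) _ _) => [p n| | |]; try by d11.
by rewrite fstnK; split=> -[x [xl _]]; exists x.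
Qed.

Section Solution.
Variables (T : tree) (P : set baire) (ans : nat -> nat).
Hypothesis kerP : is_perfect_kernel (paths T) P.
Hypothesis ansP : forall n, ans n = ~~ `[< question T n >].

(** The answer 0 means that the question holds, as [WF] yields 0 on ill-founded trees. The first
    test says that the node is scattered, the second that it lists a path. *)
Definition bit (t : nat) : bool := (ans (pairn 0 t) == 1) && (ans (pairn 3 t) == 0).

(* [accept m] holds at the value at [m] of the name of a solution: the entry
   [(i, j)] of the list is at an odd [m], and it belongs to [b_i] for even [j]
   and to [x_i] for odd [j]. *)
Definition accept (m y : nat) : bool :=
  if odd m then
    if odd (sndn m./2)
    then ~~ bit (fstn m./2) ||
      (ans (pairn 1 (pairn (fstn m./2) (pairn (sndn m./2)./2 y))) == 0)
    else y == bit (fstn m./2)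
  else if y == 0 then ans (pairn 2 0) == 1 else ans (pairn 2 y) == 0.

Let Tpre s t : prefix s t -> nodes T t -> nodes T s := @tree_prefix T s t.
Let S := scattered_part T.

Lemma ans0 n : ans n == 0 = `[< question T n >].
Proof. by rewrite ansP; case: asboolP. Qed.

Lemma ans1 n : ans n == 1 = ~~ `[< question T n >].
Proof. by rewrite ansP; case: asboolP. Qed.

Lemma bitP t : bit t -> scattered T (decode t) /\ exists x, listed T (decode t) x.
Proof.
rewrite /bit ans0 ans1 => /andP[/asboolPn + /asboolP].
by rewrite /question !fstnK !sndnK => /contrapT.
Qed.

Lemma bit_listed t x : scattered T (decode t) -> listed T (decode t) x -> bit t.
Proof.
move=> sc xl; rewrite /bit ans0 ans1; apply/andP; split; [apply/asboolPn|apply/asboolP].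
  by rewrite /question !fstnK !sndnK.
by rewrite /question !fstnK !sndnK; exists x.
Qed.

Lemma accept_ex m : exists y, accept m y.
Proof.
rewrite /accept; case: (odd m).
  case: (odd (sndn m./2)); last by exists (bit (fstn m./2)).
  case: (boolP (bit (fstn m./2))) => [/bitP [sc [x xl]]|] /=; last by exists 0.
  exists (x (sndn m./2)./2); rewrite ans0; apply/asboolP.
  by rewrite /question !(fstnK, sndnK); exists x.
have [[k Sk]|nk] := pselect (exists k, few T k); last first.
  exists 0 => /=; rewrite ans1; apply/asboolPn; rewrite /question fstnK sndnK.
  by move=> [k [_ kf]]; apply: nk; exists k.
(* The value 0 is reserved for the infinite case, so a positive one is taken; [few] is monotone. *)
exists k.+1 => /=; rewrite ans0; apply/asboolP; rewrite /question fstnK sndnK.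
exists k.+1; split; first by right.
move: Sk; rewrite !fewP // => nS /(card_le_trans _); apply: contra_not nS; apply.
by rewrite card_le_II.
Qed.

Definition result (m : nat) : nat := ex_minn (accept_ex m).

Lemma resultP m : accept m (result m) /\ forall y, y < result m -> ~~ accept m y.
Proof.
rewrite /result; case: ex_minnP => y ay ymin; split=> // z; apply: contraTN.
by move=> /ymin; rewrite -leqNgt.
Qed.

Lemma accept_entry i j y : accept (pairn i j).*2.+1 y =
  if odd j then ~~ bit i || (ans (pairn 1 (pairn i (pairn j./2 y))) == 0)
  else y == bit i.
Proof.
have fE := fstnK i j; have sE := sndnK i j; move: (pairn i j) fE sE => c fE sE.
by rewrite /accept /= odd_double /= uphalf_double fE sE.
Qed.

Lemma result_bit i j : ~~ odd j -> result (pairn i j).*2.+1 = bit i.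
Proof.
move=> /negbTE oj; have [+ _] := resultP (pairn i j).*2.+1.
by rewrite accept_entry oj => /eqP.
Qed.

Lemma result_listed i x k : scattered T (decode i) -> listed T (decode i) x ->
  result (pairn i k.*2.+1).*2.+1 = x k.
Proof.
move=> sc xl; have [+ _] := resultP (pairn i k.*2.+1).*2.+1.
have -> : forall y, accept (pairn i k.*2.+1).*2.+1 y =
    (ans (pairn 1 (pairn i (pairn k y))) == 0).
  by move=> y; rewrite accept_entry (bit_listed sc xl) /= odd_double /= uphalf_double.
rewrite ans0 => /asboolP; rewrite /question !(fstnK, sndnK) => -[y [yl <-]].
by rewrite (listed_unique sc xl yl).
Qed.

Lemma result_card0 : infinite_set S -> result 0 = 0.
Proof.
move=> /infiniteP infS; have [_ H] := resultP 0; move: H; case: (result 0) => // n.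
move=> /(_ 0 isT); rewrite /accept /= ans1 negbK => /asboolP.
rewrite /question fstnK sndnK => -[k [_ /fewP]]; case=> //.
by apply: card_le_trans infS; exact: card_leT.
Qed.

(** [few T j] holds iff [j] exceeds the number [k] of elements, so the least accepted value is the
    required one. *)
Lemma result_card k : (S #= `I_k)%card -> result 0 = k.+1.
Proof.
move=> Sk; have few_k j : few T j <-> k < j.
  by rewrite fewP // (card_le_eqr Sk) card_le_II ltnNge; split=> /negP.
have q0 : question T (pairn 2 0).
  by rewrite /question fstnK sndnK; exists k.+1; split; [left|apply/few_k].
have qS j : question T (pairn 2 j.+1) <-> k <= j.
  rewrite /question fstnK sndnK; split=> [[i [[//|->] /few_k //]]|kj].
  by exists j.+1; split; [right|apply/few_k].
have [aR lR] := resultP 0; apply/eqP; rewrite eqn_leq; apply/andP; split.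
  rewrite leqNgt; apply/negP => /lR; rewrite /accept /= ans0 => /asboolPn; apply.
  exact/qS.
move: aR; rewrite /accept /=; case: (result 0) => [|j] /=.
  by rewrite ans1 => /asboolPn.
by rewrite ans0 => /asboolP /qS.
Qed.

Definition solution : nat * (nat -> bool * baire) :=
  (result 0, fun i => (bit i, fun k => result (pairn i k.*2.+1).*2.+1)).

Lemma solution_names :
  @names (prodS natS (seqS (prodS boolS baireS))) result solution.
Proof.
split=> [|i]; first by [].
split; last by [].
exact: (result_bit i (isT : ~~ odd 0)).
Qed.

Lemma solution_correct (A : closed_baire) : paths T = A -> ScList A solution.
Proof.
move=> TA; exists P; rewrite -TA //=.
have -> : paths T `\` P = S by exact: kernel_scattered.
split; [|exact: result_card0|exact: result_card].
apply/seteqP; split=> x.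
  move=> /scattered_listed [t sc xl]; exists (code t).
  congr (_, _); first by apply: (@bit_listed _ x); rewrite CodeSeq.codeK.
  by apply: funext => k; rewrite (@result_listed _ x) ?CodeSeq.codeK.
move=> [i [bi <-]]; have [sc [y yl]] := bitP bi.
suff -> : (fun k => result (pairn i k.*2.+1).*2.+1) = y.
  exact: listed_scattered sc yl.
by apply: funext => k; apply: result_listed.
Qed.

End Solution.

(** Least accepted values are unique, so they define a partial map [Psi], and a single [Mu] over the
    decidable test computes it. *)
Lemma computable_search (b : baire -> nat -> nat -> bool) :
  PR (fun z n => b z (fstn n) (sndn n) : nat) ->
  exists2 Psi, computable Psi & forall z (r : baire),
    (forall m, b z m (r m) /\ forall y, y < r m -> ~~ b z m y) -> Psi z = Some r.
Proof.
move=> bP; pose ok z (r : baire) := forall m, b z m (r m) /\ forall y, y < r m -> ~~ b z m y.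
have ok_fun z r r' : ok z r -> ok z r' -> r = r'.
  move=> H H'; apply: funext => m; have [br lr] := H m; have [br' lr'] := H' m.
  by case: (ltngtP (r m) (r' m)) => // [/lr'|/lr]; rewrite ?br ?br'.
have /choice [Psi PsiP] : forall z, exists o : option baire,
    (forall r, o = Some r -> ok z r) /\ (forall r, ok z r -> o = Some r).
  move=> z; have [[r zr]|H] := pselect (exists r, ok z r).
    by exists (Some r); split=> [_ [<-]//|r' zr']; rewrite (ok_fun z r r').
  by exists None; split=> // r zr; case: H; exists r.
exists Psi; last by move=> z r; apply: (PsiP z).2.
have [c cP] := PR_prog (PR_negb bP).
exists (Mu c) => z r /(PsiP z).1 zr m /=; have [br lr] := zr m; split.
  by have := cP z (pairn m (r m)); rewrite fstnK sndnK br.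
move=> y /lr ny; exists 0.
by have := cP z (pairn m y); rewrite fstnK sndnK ny.
Qed.

(** [z] interleaves the input with the answers, and a name of a Boolean carries its value at
    position 0. *)
Lemma PR_accept : PR (fun z n =>
  accept (fun n => odds z (pairn n 0)) (fstn n) (sndn n) : nat).
Proof.
have bitS t : PR t -> PR (fun z n => bit (fun n => odds z (pairn n 0)) (t z n) : nat).
  by move=> tP; rewrite /bit; pr.
apply: (PR_eq (F := fun z n => if odd (fstn n) then
    if odd (sndn (fstn n)./2)
    then (~~ bit (fun n => odds z (pairn n 0)) (fstn (fstn n)./2) ||
      (odds z (pairn (pairn 1 (pairn (fstn (fstn n)./2)
         (pairn (sndn (fstn n)./2)./2 (sndn n)))) 0) == 0) : nat)
    else (sndn n == bit (fun n => odds z (pairn n 0)) (fstn (fstn n)./2) : nat)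
  else if sndn n == 0 then (odds z (pairn (pairn 2 0) 0) == 1 : nat)
  else (odds z (pairn (pairn 2 (sndn n)) 0) == 0 : nat))).
  by move=> z n; rewrite /accept; case: odd; [case: odd|case: (sndn n == 0)].
pr; apply: bitS; pr.
Qed.

Theorem ScList_reducible : weihrauch_le ScList (parallelization WF).
Proof.
have [tr trP trE] := S11_tree S11_question.
have [Psi PsiC PsiE] := computable_search
  (b := fun z => accept (fun n => odds z (pairn n 0))) PR_accept.
exists (fun p => Some (tr p)), Psi; split=> //.
  by have [c cP] := PR_prog trP; exists c => p _ [<-].
(* The perfect kernel [P] is provided by membership of [A] in the domain of [ScList]. *)
move=> p A [T pT TA] [_ [P kerP _]].
have nodesE : nodes_of p = T.
  apply/seteqP; split=> s; rewrite /nodes_of /= pT; first by case: asboolP.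
  by move=> Ts; rewrite asboolT.
have /choice [Q QP] : forall i, exists Q : tree,
    tree_names (fun s => tr p (pairn i s)) Q /\
    (question T i <-> ~ well_founded_tree Q).
  by move=> i; have [Q Q1 Q2] := trE p i; exists Q; rewrite -nodesE.
exists (tr p), Q; split=> //.
- by move=> i; exact: (QP i).1.
- by exists (fun i => `[< well_founded_tree (Q i) >]).
move=> q w qw QW; pose ans i := q (pairn i 0).
have ansP i : ans i = ~~ `[< question T i >].
  rewrite /ans (qw i : q (pairn i 0) = w i) (QW i); congr nat_of_bool.
  rewrite -asbool_neg; apply: asbool_equiv_eq; rewrite (QP i).2.
  by split=> [Qw []|/contrapT].
rewrite -TA in kerP.
exists (result ansP), (solution ansP); split.
- apply: PsiE => m; rewrite (_ : (fun n => _) = ans); first exact: resultP.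
  by apply: funext => n; rewrite odds_interleave.
- exact: solution_names.
- exact: (solution_correct kerP ansP TA).
Qed.

(** * Irreducibility of the parallelization of WF *)

Lemma fstn_sndn_le m : fstn m <= m /\ sndn m <= m.
Proof.
have := Cantor.to_nat_non_decreasing (fstn m) (sndn m).
by rewrite -/(pairn _ _) pairnK; lia.
Qed.

Lemma course_of_values (G : baire -> nat -> nat) :
  (forall p p' m, (forall i, i < m -> p i = p' i) -> G p m = G p' m) ->
  exists p : baire, forall m, p m = G p m.
Proof.
move=> GP; pose g := fix g j : baire := if j is j'.+1 then G (g j') else fun=> 0.
(* The approximation [g j] has its final values below [j]. *)
have gE m : forall j, m < j -> g j m = g m.+1 m.
  have [n] := ubnP m; elim: n m => // n IH m /ltnSE mn [//|j] mj /=.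
  by apply: GP => i im; rewrite !(IH i) //; lia.
by exists (fun m => g m.+1 m) => m /=; apply: GP => i im; rewrite gE.
Qed.

(** A fixed point: [p] names trees whose ill-foundedness is decided by what [N] says about [p]
    itself. The name [p] may be non-computable, as a reduction acts on all names. *)
Lemma S11_diagonal N : S11 N ->
  exists (p : baire) (Q : nat -> tree), @names (seqS treeS) p Q /\
    forall n, N p (pairn n n) <-> ~ well_founded_tree (Q n).
Proof.
move=> [F FP FE].
(* Each instance [j < k] has to be consistent with the first [k] values of [p] and of [s]. So only
   [p] below [size s] matters, and [size s] is at most the position where membership of [s] is
   stored. *)
pose R (p : baire) (s : seq nat) n := forall k j, k <= size s -> j < k ->
  exists p' f : baire, [/\ forall i, i < k -> p' i = p i,
    forall i, i < k -> f i = nth 0 s i &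
    F (interleave p' f) (pairn (pairn n n) j) = 0].
have [|p pE] := @course_of_values (fun p m => `[< R p (decode (sndn m)) (fstn m) >]).
  suff RP p p' s n : (forall i, i < size s -> p i = p' i) -> R p s n -> R p' s n.
    move=> p p' m pp'; congr nat_of_bool; apply: asbool_equiv_eq.
    have le : size (decode (sndn m)) <= m.
      apply: leq_trans (size_leq_code _) _; rewrite CodeSeq.decodeK.
      exact: (fstn_sndn_le m).2.
    by split; apply: RP => i il; rewrite pp' //; apply: leq_trans le.
  move=> pp' H k j ks jk; have [q [f [qp fs Fq]]] := H k j ks jk.
  by exists q, f; split=> // i ik; rewrite qp // pp' //; apply: leq_trans ks.
have R0 n : [set s | R p s n] !=set0 by exists [::] => -[].
have Rpre n s t : prefix s t -> R p t n -> R p s n.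
  move=> /prefixP [u ->] H k j ks jk.
  have [|q [f [qp fs Fq]]] := H k j _ jk; first by rewrite size_cat; lia.
  exists q, f; split=> // i ik; rewrite fs // nth_cat ifT //.
  exact: leq_trans ik ks.
exists p, (fun n => Tree (R0 n) (Rpre n)); split.
  by move=> n s /=; rewrite pE fstnK sndnK CodeSeq.codeK.
move=> n; rewrite FE; split=> [[f fP] wf|nwf].
  suff : paths (Tree (R0 n) (Rpre n)) f by rewrite wf.
  move=> l k j; rewrite size_mkseq => kl jk; exists p, f; split=> // i ik.
  by rewrite nth_mkseq //; apply: leq_trans ik kl.
have [f fP] : exists f, paths (Tree (R0 n) (Rpre n)) f.
  apply: contrapT => nf; apply: nwf; apply/seteqP; split=> // f fP.
  by apply: nf; exists f.
exists f => j; have [K KP] := PR_cont FP (interleave p f) (pairn (pairn n n) j).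
(* The node of length [k] yields [p'] and [f'] that agree with [p] and [f] as far as this
   computation looks. *)
pose k := maxn K j.+1.
have [||p' [f' [pp' ff' <-]]] := fP k k j; rewrite ?size_mkseq ?leq_maxr //.
symmetry; apply: KP => i iK; have ik : i./2 < k.
  by apply: leq_ltn_trans (half_leq (leqnn _)) _; lia.
rewrite /interleave; case: odd; last exact: pp'.
by rewrite ff' // nth_mkseq.
Qed.

(** * Finite parts of solutions *)

Definition avoids (T : set (seq nat)) (s : seq nat) :=
  forall u, prefix s u -> T u -> pathless T u.

Lemma avoidsP (T : tree) s :
  avoids T s <-> ~ exists2 x, scattered_part T x & s = mkseq x (size s).
Proof.
have Tpre := @tree_prefix T; split=> [H [x [xT [n xn]] sx]|H u su Tu].
  pose m := maxn (size s) n.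
  have /(pathlessP Tpre (xT m)) : pathless T (mkseq x m).
    by apply: H (xT m); rewrite sx prefix_mkseq // leq_maxl.
  apply; split; first by apply: scattered_prefix xn; rewrite prefix_mkseq // leq_maxr.
  by exists x; rewrite ?size_mkseq.
apply/(pathlessP Tpre Tu) => -[uT [x ux xT]]; apply: H; exists x.
  by split=> //; exists (size u); rewrite -ux.
by apply: (@prefix_mkseqE x s (size u)); rewrite -ux.
Qed.

Lemma S11_avoids : S11 (fun a c => avoids (nodes_of a) (decode c)).
Proof.
apply: (@S11_eq (fun a c => forall d, prefix (decode c) (decode d) -> a d = 1 ->
  pathless (nodes_of a) (decode d))).
  move=> a c; split=> H d cd; last first.
    by move=> ad; apply: H => //; rewrite /nodes_of /= CodeSeq.decodeK.
  by move=> ad; have := H (code d); rewrite CodeSeq.codeK; apply.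
d11; apply: (S11_subst S11_pathless); pr.
Qed.

(** In a name of a solution the list occupies the odd positions; within entry [i] the bit is at 0
    and the point at the odd places. *)
Definition entry_bit (q : baire) i := q (pairn i 0).*2.+1.
Definition entry_pt (q : baire) i : baire := fun k => q (pairn i k.*2.+1).*2.+1.

(* [z] cannot be changed beyond [k] into a name of an element of [ScList A]
   with first component [n], where [a] names [A]. *)
Definition bad (a : baire) n (z : baire) k := z 0 <> n \/
  exists i, i < k /\ ((entry_bit z i <> 0 /\ entry_bit z i <> 1) \/
    (entry_bit z i = 1 /\ avoids (nodes_of a) (mkseq (entry_pt z i) k))).

(* If [n] is the first component of the solutions for the image of [p], this
   says that the reduction given by [c1] and [c2] answers 1 at [i]. *)
Definition forced (c1 c2 : prog) (p : baire) n i := exists a : baire,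
  (forall j, eval p c1 j (a j)) /\
  forall l k, bad a n (nth 0 (decode l)) k \/
    exists z : baire, (forall m, m < k -> z m = nth 0 (decode l) m) /\
      eval (interleave p z) c2 (pairn i 0) 1.

Lemma S11_forced c1 c2 : S11 (fun p n => forced c1 c2 p (fstn n) (sndn n)).
Proof.
rewrite /forced /bad /entry_bit.
d11.
- apply: (S11_app2 (P := fun p => eval p c1) (S11_eval c1)); pr.
- apply: S11_eq (S11_subst S11_avoids (G := fun p _ => odds p) (t := fun p n =>
    code (mkseq (fun k => nth 0 (decode (sndn (fstn (fstn n))))
      (pairn (sndn n) k.*2.+1).*2.+1) (sndn (fstn n)))) _ _) => [p n| |]; try by pr.
  by rewrite CodeSeq.codeK.
- apply: (S11_app2 (P := fun p => eval p c2) (S11_eval c2)); pr.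
Qed.

Section Forced.
Variables (T : tree) (a : baire) (A : closed_baire).
Hypotheses (aT : tree_names a T) (TA : paths T = A).

Lemma nodes_of_names : nodes_of a = T.
Proof.
apply/seteqP; split=> s; rewrite /nodes_of /= aT; first by case: asboolP.
by move=> Ts; rewrite asboolT.
Qed.

Lemma ScList_enum (n : nat) (l l' : nat -> bool * baire) : ScList A (n, l) ->
  [set x | exists i, l i = (true, x)] = [set x | exists i, l' i = (true, x)] ->
  ScList A (n, l').
Proof. by move=> [P kP [E inf fin]] ll'; exists P => //; split=> //; rewrite E. Qed.

Lemma ScList_scattered n l : ScList A (n, l) ->
  scattered_part T = [set x | exists i, l i = (true, x)].
Proof.
move=> [P kP [<- _ _]]; rewrite -TA -(@kernel_scattered T (@tree_prefix T) P) //.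
by rewrite -TA in kP.
Qed.

(** Among the first [k] entries, each point with bit 1 agrees up to [k] with a member of the
    scattered part. Putting these members in place and appending [l] gives a solution. *)
Lemma not_bad_extend n l (z : baire) k : ScList A (n, l) -> ~ bad a n z k ->
  exists (q : baire) l', [/\ forall m, m < k -> q m = z m, ScList A (n, l') &
    @names (prodS natS (seqS (prodS boolS baireS))) q (n, l')].
Proof.
move=> Al /not_orP [/contrapT z0 zbad].
have bit01 i : i < k -> entry_bit z i = (entry_bit z i == 1) :> nat.
  move=> ik; case E: (entry_bit z i) => [|[|b]] //.
  by case: zbad; exists i; split=> //; left; rewrite E.
have /choice [y yP] : forall i, exists x : baire, i < k -> entry_bit z i = 1 ->
    scattered_part T x /\ mkseq x k = mkseq (entry_pt z i) k.
  move=> i; have [[ik zi]|] := pselect (i < k /\ entry_bit z i = 1); last first.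
    by move=> H; exists (fun=> 0) => ik zi; case: H.
  have : ~ avoids T (mkseq (entry_pt z i) k).
    move=> av; apply: zbad; exists i; split=> //; right; split=> //.
    by rewrite nodes_of_names.
  by move=> /avoidsP /contrapT [x xS]; rewrite size_mkseq => E; exists x.
pose l' i := if i < k then
  if entry_bit z i == 1 then (true, y i) else (false, entry_pt z i) else l (i - k).
(* Elsewhere [q] copies [z]: at 0, where [z 0 = n], and at the positions that a name leaves free. *)
pose q : baire := fun m => if odd m then
    if odd (sndn m./2) then (l' (fstn m./2)).2 (sndn m./2)./2
    else if sndn m./2 == 0 then nat_of_bool (l' (fstn m./2)).1 else z m
  else z m.
have qE i j : q (pairn i j).*2.+1 = if odd j then (l' i).2 j./2
    else if j == 0 then nat_of_bool (l' i).1 else z (pairn i j).*2.+1.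
  have fE := fstnK i j; have sE := sndnK i j; move: (pairn i j) fE sE => c fE sE.
  by rewrite /q /= odd_double /= uphalf_double fE sE.
exists q, l'; split.
- move=> m mk; rewrite /q; case om: (odd m) => //.
  have mE : m = (pairn (fstn m./2) (sndn m./2)).*2.+1.
    by rewrite pairnK -[LHS]odd_double_half om.
  (* The pairing bounds its components, so the positions below [k] only concern entries and digits
     below [k]. *)
  have half_lt : m./2 < k by lia.
  have ik : fstn m./2 < k by apply: leq_ltn_trans (fstn_sndn_le _).1 half_lt.
  have jk : sndn m./2 < k by apply: leq_ltn_trans (fstn_sndn_le _).2 half_lt.
  move: mE ik jk; move: (fstn _) (sndn _) => i j mE ik jk; rewrite /l' ik.
  case oj: (odd j).
    have jE : j = j./2.*2.+1 by rewrite -[LHS]odd_double_half oj.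
    have zE : entry_pt z i j./2 = z m by rewrite /entry_pt -jE -mE.
    case: eqP => zi /=; last exact: zE.
    have [_ /mkseq_eqP -> //] := yP i ik zi; lia.
  case: eqP => // j0; rewrite mE j0 -/(entry_bit z i) [RHS]bit01 //.
  by case: eqP.
- apply: (ScList_enum Al); rewrite -(ScList_scattered Al); apply/seteqP; split=> x.
    rewrite {1}(ScList_scattered Al) => -[i li]; exists (i + k).
    by rewrite /l' ltnNge leq_addl addnK.
  move=> [i]; rewrite /l'; case: ltnP => [ik|ki li].
    by case: eqP => // zi [<-]; have [] := yP i ik zi.
  by rewrite (ScList_scattered Al); exists (i - k).
- split=> [|i]; first exact: z0.
  split; first exact: (qE i 0).
  apply: funext => t; rewrite [LHS](qE i t.*2.+1) /= odd_double /=.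
  by rewrite uphalf_double.
Qed.

(** The bits and points inspected by [bad] may lie at positions beyond [k], so [c] codes a part of
    [q] that is long enough to contain them. *)
Lemma solution_not_bad n l (q : baire) k : ScList A (n, l) ->
  @names (prodS natS (seqS (prodS boolS baireS))) q (n, l) ->
  exists c, (forall m, m < k -> nth 0 (decode c) m = q m) /\
    ~ bad a n (nth 0 (decode c)) k.
Proof.
move=> Al [q0 ql].
have [M MP] : exists M, forall i m, i < k -> M <= m -> forall t, t < k ->
    (pairn i t.*2.+1).*2.+1 < m.
  apply: eventually_all => i _.
  have [M MP] : exists M, forall t m, t < k -> M <= m -> (pairn i t.*2.+1).*2.+1 < m.
    by apply: eventually_all => t _; exists (pairn i t.*2.+1).*2.+2 => m.
  exists M => m Mm t tk; exact: MP tk Mm.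
have [M' M'P] : exists M, forall i m, i < k -> M <= m -> (pairn i 0).*2.+1 < m.
  by apply: eventually_all => i _; exists (pairn i 0).*2.+2 => m.
pose K := maxn (maxn M M') k.+1; exists (code (mkseq q K)); rewrite CodeSeq.codeK.
have nthE m : m < K -> nth 0 (mkseq q K) m = q m by move=> mK; rewrite nth_mkseq.
split=> [m mk|]; first by rewrite nthE //; lia.
have bitE i : i < k -> entry_bit (nth 0 (mkseq q K)) i = (l i).1.
  move=> ik; rewrite /entry_bit nthE; first exact: (ql i).1.
  apply: (M'P i) => //; lia.
move=> [|[i [ik]]]; first by rewrite nthE //; lia.
rewrite bitE // => -[[]|[li]]; first by case: (l i).1.
rewrite nodes_of_names => /avoidsP; apply.
rewrite (ScList_scattered Al); exists (l i).2.
  by exists i; case: (l i) li => -[].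
rewrite size_mkseq; apply/mkseq_eqP => t tk.
rewrite /entry_pt nthE; last by apply: (MP i) => //; lia.
by have /= <- := (ql i).2.
Qed.

End Forced.

Theorem WF_not_reducible : ~ weihrauch_le (parallelization WF) ScList.
Proof.
move=> [Phi [Psi [[c1 c1P] [c2 c2P] H]]].
(* The input [p] is built before the first component [n] of a solution is known, so it holds one
   tree for each candidate [n]. *)
have [p [Q [pQ Qdiag]]] := S11_diagonal (S11_forced c1 c2).
have [|a [A [Phip [T aT TA] [[n l] Al] HA]]] := H p Q pQ.
  by exists (fun i => `[< well_founded_tree (Q i) >]).
have ansP i q l' : @names (prodS natS (seqS (prodS boolS baireS))) q (n, l') ->
    ScList A (n, l') ->
    eval (interleave p q) c2 (pairn i 0) `[< well_founded_tree (Q i) >].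
  move=> qn Al'; have [r [w [Psir rw ww]]] := HA q (n, l') qn Al'.
  by rewrite -(ww i) -(rw i); exact: c2P.
(* At the index equal to the actual first component, the reduction makes [forced] equivalent to
   well-foundedness, while the diagonal tree makes it equivalent to ill-foundedness. *)
have := Qdiag n; rewrite fstnK sndnK; suff -> : forced c1 c2 p n n <->
    well_founded_tree (Q n) by tauto.
split=> [[a' [a'P forcedP]]|wf].
  (* If [Q n] were ill-founded, a finite part of the name [q] would force the output 0, while
     [forced] supplies a continuation of it with output 1. *)
  apply: contrapT => nwf.
  have Ea : a' = a.
    by apply: funext => j; apply: eval_fun (a'P j) _; exact: c1P.
  have [q qn] := @names_surj (prodS natS (seqS (prodS boolS baireS))) (n, l).
  have := ansP n q l qn Al; rewrite asboolF // => ev0.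
  have [k kP] := eval_cont ev0.
  have [c [cq nbad]] := solution_not_bad aT TA k Al qn.
  have [|[z [zc ev1]]] := forcedP c k; first by rewrite Ea.
  suff /eval_fun /(_ ev1) : eval (interleave p z) c2 (pairn n 0) 0 by [].
  apply: kP => i ik; rewrite /interleave; case: odd => //.
  have ik' : i./2 < k by lia.
  by rewrite zc // cq.
exists a; split=> [j|c k]; first exact: c1P.
have [|nbad] := pselect (bad a n (nth 0 (decode c)) k); first by left.
have [q [l' [qz Al' qn]]] := not_bad_extend aT TA Al nbad.
right; exists q; split=> //.
by have := ansP n q l' qn Al'; rewrite asboolT.
Qed.

Theorem theorem4p29 : weihrauch_lt ScList (parallelization WF).
Proof. by split; [exact: ScList_reducible|exact: WF_not_reducible]. Qed.
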